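(* For every integer $n>1$ we have $\|n\| \le A\log n$, where $A=\dfrac{41}{\log 55296}$.
   Context: For a positive integer $n$, $\|n\|$ (the integer complexity of $n$) denotes the smallest number of $1$s needed to write $n$ as an expression using only the number $1$, additions and multiplications (with arbitrary parentheses). $\log$ is the natural logarithm. *)

(* Defs.v *)
From Stdlib Require Import Arith Lia Wf_nat Classical ClassicalEpsilon Reals.

Inductive expr : Set :=
| One : expr
| Add : expr -> expr -> expr
| Mul : expr -> expr -> expr.

Fixpoint eval (e : expr) : nat :=
  match e with
  | One => 1
  | Add a b => eval a + eval b
  | Mul a b => eval a * eval b
  end.

Fixpoint ones (e : expr) : nat :=
  match e with
  | One => 1
  | Add a b => ones a + ones b
  | Mul a b => ones a + ones b
  end.

Definition is_complexity (n k : nat) : Prop :=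
  (exists e : expr, eval e = n /\ ones e = k) /\
  (forall e : expr, eval e = n -> k <= ones e).

(* Only meaningful for n > 0: no expression evaluates to 0, and
   [complexity 0] is an arbitrary number. *)
Definition complexity (n : nat) : nat :=
  epsilon (inhabits 0) (is_complexity n).

Lemma expr_of_pos (n : nat) : 0 < n -> exists e : expr, eval e = n.
Proof.
  induction n as [|[|n] IH]; intros Hn; [lia | now exists One |].
  destruct IH as [e He]; [lia|].
  exists (Add One e); simpl; now rewrite He.
Qed.

Lemma is_complexity_unique (n k l : nat) :
  is_complexity n k -> is_complexity n l -> k = l.
Proof.
  intros [[e [He Hk]] Hmk] [[f [Hf Hl]] Hml].
  specialize (Hmk f Hf); specialize (Hml e He); lia.
Qed.

Lemma complexity_spec (n : nat) : 0 < n -> is_complexity n (complexity n).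
Proof.
  intros Hn; unfold complexity; apply epsilon_spec.
  destruct (expr_of_pos n Hn) as [e0 He0].
  destruct (dec_inh_nat_subset_has_unique_least_element
              (fun k => exists e, eval e = n /\ ones e = k))
    as [k [[Hk Hmin] _]].
  - intros k; apply classic.
  - now exists (ones e0), e0.
  - exists k; split; [exact Hk|].
    intros e He; apply Hmin; now exists e.
Qed.

(* Main.v *)
(* Let A = 41 / ln 55296. If x = p y + r with 0 <= r < p, the deficit A ln x - ||x||
   is at least that of y plus the gain A ln p - ||p|| - ||r||. In a least
   counterexample N no chain of such steps ending at a number > 1 has nonnegative
   total gain. Small cases give N = -1 modulo 12, so write
   N + 1 = 2^a 3^b 5^c 7^d 11^e 17^f w with w prime to 2, 3, 5, 7, 11 and 17.
   For p among these primes, dividing out p^e takes e (losing) steps with the digit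
   p - 1; the next digit r is smaller, and leads to a number that is -(r + 1) / p
   modulo the part M of N + 1 prime to p. From the classes -k / p there are periodic
   sequences of divisions by 2 and 3 with positive gain, each using up a factor of M,
   so one gains linearly in a and b. For p = 5, 7, 11, 17 this forces c, d, e, f to
   grow linearly with a and b. Then p = 2 or p = 3 wins. Dividing out 2^a leads to
   -1/2, from where one reaches -1/8, -1/16 and -1/32; as 3, 9, 17 and 385 = 5 7 11 are
   1 modulo 2, 8, 16 and 32, division by them preserves these four classes and gains.
   Dividing out 3^b leads to -1/3, from where one reaches -1/9 and -1/27; here the
   gain comes from 4 modulo 3, from 10 modulo 9, and from 28 and 136 modulo 27. The
   first wins for a up to about 9 b / 4 and the second for larger a, apart from small
   a or b, where explicit finite sequences of divisions are checked. *)

Require Import Defs.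
From Stdlib Require Import Reals.
From Stdlib Require Import ZArith Znumtheory Zpow_facts List Bool Lia Lra.
Import ListNotations.

Local Open Scope Z_scope.

(** * Gain of a division step *)

Lemma eval_pos (e : expr) : (0 < eval e)%nat.
Proof. induction e; simpl; nia. Qed.

Lemma complexity_le (e : expr) : (complexity (eval e) <= ones e)%nat.
Proof. now apply (complexity_spec _ (eval_pos e)). Qed.

Lemma complexity_expr (n : nat) : (0 < n)%nat ->
  exists e : expr, eval e = n /\ ones e = complexity n.
Proof. intros Hn. now destruct (complexity_spec n Hn). Qed.

Lemma complexity_add (m n : nat) : (0 < m)%nat -> (0 < n)%nat ->
  (complexity (m + n) <= complexity m + complexity n)%nat.
Proof.
  intros Hm Hn.
  destruct (complexity_expr m Hm) as [e [<- <-]].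
  destruct (complexity_expr n Hn) as [f [<- <-]].
  apply (complexity_le (Defs.Add e f)).
Qed.

Lemma complexity_mul (m n : nat) : (0 < m)%nat -> (0 < n)%nat ->
  (complexity (m * n) <= complexity m + complexity n)%nat.
Proof.
  intros Hm Hn.
  destruct (complexity_expr m Hm) as [e [<- <-]].
  destruct (complexity_expr n Hn) as [f [<- <-]].
  apply (complexity_le (Defs.Mul e f)).
Qed.

(** Upper bounds for the complexities of 1 to 17. The entry 0 at index 0 records that a zero digit
    needs no addition. *)
Definition cost (d : Z) : Z :=
  nth (Z.to_nat d) [0; 1; 2; 3; 4; 5; 5; 6; 6; 6; 7; 8; 7; 8; 8; 8; 8; 9] 0.

Lemma cost_spec (d : Z) : 1 <= d <= 17 ->
  Z.of_nat (complexity (Z.to_nat d)) <= cost d.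
Proof.
  intros Hd.
  assert (H1 := complexity_le One). simpl in H1.
  assert (H2 := complexity_add 1 1 ltac:(lia) ltac:(lia)).
  assert (H3 := complexity_add 2 1 ltac:(lia) ltac:(lia)).
  assert (H4 := complexity_add 3 1 ltac:(lia) ltac:(lia)).
  assert (H5 := complexity_add 4 1 ltac:(lia) ltac:(lia)).
  assert (H6 := complexity_mul 2 3 ltac:(lia) ltac:(lia)).
  assert (H7 := complexity_add 6 1 ltac:(lia) ltac:(lia)).
  assert (H8 := complexity_mul 2 4 ltac:(lia) ltac:(lia)).
  assert (H9 := complexity_mul 3 3 ltac:(lia) ltac:(lia)).
  assert (H10 := complexity_add 9 1 ltac:(lia) ltac:(lia)).
  assert (H11 := complexity_add 10 1 ltac:(lia) ltac:(lia)).
  assert (H12 := complexity_mul 3 4 ltac:(lia) ltac:(lia)).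
  assert (H13 := complexity_add 12 1 ltac:(lia) ltac:(lia)).
  assert (H14 := complexity_mul 2 7 ltac:(lia) ltac:(lia)).
  assert (H15 := complexity_mul 3 5 ltac:(lia) ltac:(lia)).
  assert (H16 := complexity_mul 4 4 ltac:(lia) ltac:(lia)).
  assert (H17 := complexity_add 16 1 ltac:(lia) ltac:(lia)).
  simpl Nat.add in *. simpl Nat.mul in *.
  assert (d = 1 \/ d = 2 \/ d = 3 \/ d = 4 \/ d = 5 \/ d = 6 \/ d = 7 \/ d = 8
    \/ d = 9 \/ d = 10 \/ d = 11 \/ d = 12 \/ d = 13 \/ d = 14 \/ d = 15
    \/ d = 16 \/ d = 17) as Hc by lia.
  repeat (destruct Hc as [-> | Hc]); try subst d;
    match goal with |- context [Z.to_nat ?z] =>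
      let v := eval compute in (Z.to_nat z) in change (Z.to_nat z) with v end;
    match goal with |- _ <= cost ?z =>
      let v := eval compute in (cost z) in change (cost z) with v end; lia.
Qed.

Definition is_base (p : Z) : bool := existsb (Z.eqb p) [2; 3; 5; 7; 11; 17].

(* [10000 * A * ln p] rounded down, with [A = 41 / ln 55296]; slacks and gains are
   measured in the same unit [1 / 10000]. *)
Definition weight (p : Z) : Z :=
  match p with
  | 2 => 26023 | 3 => 41246 | 5 => 60424 | 7 => 73057 | 11 => 90026 | 17 => 106370
  | _ => 0
  end.

Lemma is_base_cases (p : Z) : is_base p = true ->
  p = 2 \/ p = 3 \/ p = 5 \/ p = 7 \/ p = 11 \/ p = 17.
Proof.
  unfold is_base; simpl; rewrite !orb_true_iff, !Z.eqb_eq. intuition congruence.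
Qed.

Lemma ln_Zpow (p q : Z) (e f : nat) : 1 <= p -> 1 <= q ->
  p ^ Z.of_nat e <= q ^ Z.of_nat f ->
  (INR e * ln (IZR p) <= INR f * ln (IZR q))%R.
Proof.
  intros Hp Hq H. apply IZR_le in Hp, Hq, H.
  rewrite <- !pow_IZR in H.
  rewrite <- !ln_pow by lra.
  destruct H as [H | ->]; [|lra].
  left. apply ln_increasing; [apply pow_lt; lra | exact H].
Qed.

Definition rate : R := 41 / ln 55296.

(** As 55296 = 2^11 3^3, one has A (11 ln 2 + 3 ln 3) = 41. Comparing powers of 2 and 3 in both
    directions then pins down A ln 2 and A ln 3, and the other logarithms are bounded below by
    multiples of ln 2. *)
Lemma weight_spec (p : Z) : is_base p = true ->
  (IZR (weight p) <= 10000 * (rate * ln (IZR p)))%R.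
Proof.
  assert (Hln : (ln 55296 = 11 * ln 2 + 3 * ln 3)%R).
  { replace 55296%R with (2 ^ 11 * 3 ^ 3)%R by lra.
    rewrite ln_mult, !ln_pow by lra. simpl. lra. }
  assert (H2 : (0 < ln 2)%R) by (rewrite <- ln_1; apply ln_increasing; lra).
  assert (H3 : (0 < ln 3)%R) by (rewrite <- ln_1; apply ln_increasing; lra).
  assert (Hr : (rate * (11 * ln 2 + 3 * ln 3) = 41)%R).
  { unfold rate. rewrite Hln. field. lra. }
  assert (Hrp : (0 < rate)%R).
  { unfold rate. rewrite Hln. apply Rdiv_lt_0_compat; lra. }
  assert (Hmul : forall u v, (u <= v -> rate * u <= rate * v)%R).
  { intros u v Huv. apply Rmult_le_compat_l; lra. }
  (* The exponents come from close rational approximations to the ratios of logarithms; 485/306 and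
     1054/665 are convergents of log 3 / log 2. *)
  assert (E1 := Hmul _ _ (ln_Zpow 3 2 306 485
    ltac:(lia) ltac:(lia) ltac:(vm_compute; discriminate))).
  assert (E2 := Hmul _ _ (ln_Zpow 2 3 1054 665
    ltac:(lia) ltac:(lia) ltac:(vm_compute; discriminate))).
  assert (E5 := Hmul _ _ (ln_Zpow 2 5 339 146
    ltac:(lia) ltac:(lia) ltac:(vm_compute; discriminate))).
  assert (E7 := Hmul _ _ (ln_Zpow 2 7 306 109
    ltac:(lia) ltac:(lia) ltac:(vm_compute; discriminate))).
  assert (E11 := Hmul _ _ (ln_Zpow 2 11 1491 431
    ltac:(lia) ltac:(lia) ltac:(vm_compute; discriminate))).
  assert (E17 := Hmul _ _ (ln_Zpow 2 17 1075 263
    ltac:(lia) ltac:(lia) ltac:(vm_compute; discriminate))).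
  rewrite !INR_IZR_INZ in *. simpl Z.of_nat in *.
  intros Hp. apply is_base_cases in Hp.
  repeat (destruct Hp as [-> | Hp]); try subst p; simpl weight; lra.
Qed.

Definition slack (x : Z) : R :=
  (10000 * (rate * ln (IZR x) - INR (complexity (Z.to_nat x))))%R.

Definition gain (p r : Z) : Z := weight p - 10000 * (cost p + cost r).

(** Writing the number as [p * y + r] needs at most ||p|| + ||y|| + ||r|| ones, without the last
    term if [r = 0], and ln is increasing. *)
Lemma slack_step (p r y : Z) : is_base p = true -> 0 <= r < p -> 0 < y ->
  (IZR (gain p r) + slack y <= slack (p * y + r))%R.
Proof.
  intros Hp Hr Hy.
  assert (Hw := weight_spec p Hp).
  assert (Hc : 2 <= p <= 17) by (apply is_base_cases in Hp; lia).
  assert (Hrate : (0 < rate)%R).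
  { unfold rate. apply Rdiv_lt_0_compat; [lra|].
    rewrite <- ln_1. apply ln_increasing; lra. }
  assert (Hln : (rate * ln (IZR p) + rate * ln (IZR y)
                 <= rate * ln (IZR (p * y + r)))%R).
  { rewrite <- Rmult_plus_distr_l. apply Rmult_le_compat_l; [lra|].
    rewrite <- ln_mult by (apply IZR_lt; lia). rewrite <- mult_IZR.
    assert (0 < p * y) by nia.
    destruct (Z.eq_dec r 0) as [-> | Hr0]; [rewrite Z.add_0_r; lra|].
    left. apply ln_increasing; apply IZR_lt; lia. }
  assert (Hcost : Z.of_nat (complexity (Z.to_nat (p * y + r)))
                  <= cost p + cost r + Z.of_nat (complexity (Z.to_nat y))).
  { assert (Hcp := cost_spec p ltac:(lia)).
    assert (Hm := complexity_mul (Z.to_nat p) (Z.to_nat y) ltac:(lia) ltac:(lia)).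
    rewrite <- Z2Nat.inj_mul in Hm by lia.
    destruct (Z.eq_dec r 0) as [-> | Hr0].
    - rewrite Z.add_0_r. change (cost 0) with 0. lia.
    - assert (Hcr := cost_spec r ltac:(lia)).
      assert (Ha := complexity_add (Z.to_nat (p * y)) (Z.to_nat r)
                      ltac:(nia) ltac:(lia)).
      rewrite <- Z2Nat.inj_add in Ha by nia. lia. }
  apply IZR_le in Hcost. rewrite !plus_IZR, <- !INR_IZR_INZ in Hcost.
  unfold slack, gain. rewrite minus_IZR, mult_IZR, plus_IZR. lra.
Qed.

(** * Residue classes under sequences of steps *)

(* For [ps] whose product divides [a], divides [a * w + b] by the members of [ps] in
   turn: the result is [a' * w + b'], the digits met do not depend on [w] and have
   total gain [g], and [a * w + b = P * (a' * w + b') + R]. *)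
Fixpoint run (ps : list Z) (a b : Z) : option (Z * Z * Z * Z * Z) :=
  match ps with
  | [] => Some (a, b, 0, 1, 0)
  | p :: ps' =>
      if is_base p && (a mod p =? 0) then
        match run ps' (a / p) (b / p) with
        | Some (a', b', g, P, R) =>
            Some (a', b', g + gain p (b mod p), p * P, p * R + b mod p)
        | None => None
        end
      else None
  end.

(** Each member of [ps] divides the current coefficient of [w], so the digits depend on [b] alone.
    The bound [2 <= P] makes the end of a nonempty path smaller than a positive start. *)
Lemma run_spec (ps : list Z) : forall a b a' b' g P R,
  run ps a b = Some (a', b', g, P, R) ->
  1 <= P /\ 0 <= R /\ (ps <> [] -> 2 <= P) /\
  forall w, a * w + b = P * (a' * w + b') + R /\
    (0 < a' * w + b' ->
     (IZR g + slack (a' * w + b') <= slack (a * w + b))%R).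
Proof.
  induction ps as [|p ps IH]; intros a b a' b' g P R H; simpl in H.
  - injection H as <- <- <- <- <-.
    repeat split; try lia; [congruence|]. intros _. simpl. lra.
  - destruct (is_base p) eqn:Hp; [|discriminate].
    destruct (Z.eqb_spec (a mod p) 0) as [Ha|]; [|discriminate]. simpl in H.
    destruct (run ps (a / p) (b / p)) as [[[[[a1 b1] g1] P1] R1]|] eqn:E;
      [|discriminate].
    injection H as <- <- <- <- <-.
    apply IH in E. destruct E as (HP & HR & _ & Hw).
    assert (Hp2 : 2 <= p) by (apply is_base_cases in Hp; lia).
    assert (Hb := Z.mod_pos_bound b p ltac:(lia)).
    assert (Ea := Z.div_mod a p ltac:(lia)).
    assert (Eb := Z.div_mod b p ltac:(lia)).
    split; [nia|]. split; [nia|]. split; [nia|].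
    intros w. destruct (Hw w) as [He Hs]. split; [nia|].
    intros Hpos. specialize (Hs Hpos).
    assert (Hy : 0 < a / p * w + b / p) by nia.
    assert (Hst := slack_step p (b mod p) (a / p * w + b / p) Hp Hb Hy).
    replace (p * (a / p * w + b / p) + b mod p) with (a * w + b) in Hst by nia.
    rewrite plus_IZR. lra.
Qed.

(* [Learn] nodes split the unknown [w] of an affine form [a * w + b] modulo
   2 or 3; a leaf divides successively by the members of [path]. *)
Inductive tree : Set :=
| Leaf (path alt : list Z)
| Learn2 (t0 t1 : tree)
| Learn3 (t0 t1 t2 : tree).

Fixpoint check (test : list Z -> list Z -> Z -> Z -> bool) (t : tree) (a b : Z)
  : bool :=
  match t with
  | Leaf path alt => test path alt a b
  | Learn2 t0 t1 => check test t0 (2 * a) b && check test t1 (2 * a) (b + a)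
  | Learn3 t0 t1 t2 =>
      check test t0 (3 * a) b && check test t1 (3 * a) (b + a)
      && check test t2 (3 * a) (b + 2 * a)
  end.

Lemma check_spec (test : list Z -> list Z -> Z -> Z -> bool) (Q : Z -> Prop) :
  (forall path alt a b, test path alt a b = true ->
     forall w, 0 <= w -> Q (a * w + b)) ->
  forall t a b, check test t a b = true -> forall w, 0 <= w -> Q (a * w + b).
Proof.
  intros Htest t. induction t as [path alt | t0 IH0 t1 IH1 | t0 IH0 t1 IH1 t2 IH2];
    intros a b H w Hw; simpl in H.
  - now apply (Htest path alt).
  - apply andb_true_iff in H. destruct H as [H0 H1].
    assert (E := Z.div_mod w 2 ltac:(lia)).
    assert (Hb := Z.mod_pos_bound w 2 ltac:(lia)).
    assert (Hq : 0 <= w / 2) by (apply Z.div_pos; lia).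
    assert (Hc : w mod 2 = 0 \/ w mod 2 = 1) by lia.
    destruct Hc as [Hc | Hc]; rewrite Hc in E.
    + replace (a * w + b) with (2 * a * (w / 2) + b) by nia. now apply IH0.
    + replace (a * w + b) with (2 * a * (w / 2) + (b + a)) by nia. now apply IH1.
  - apply andb_true_iff in H. destruct H as [H H2].
    apply andb_true_iff in H. destruct H as [H0 H1].
    assert (E := Z.div_mod w 3 ltac:(lia)).
    assert (Hb := Z.mod_pos_bound w 3 ltac:(lia)).
    assert (Hq : 0 <= w / 3) by (apply Z.div_pos; lia).
    assert (Hc : w mod 3 = 0 \/ w mod 3 = 1 \/ w mod 3 = 2) by lia.
    destruct Hc as [Hc | [Hc | Hc]]; rewrite Hc in E.
    + replace (a * w + b) with (3 * a * (w / 3) + b) by nia. now apply IH0.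
    + replace (a * w + b) with (3 * a * (w / 3) + (b + a)) by nia. now apply IH1.
    + replace (a * w + b) with (3 * a * (w / 3) + (b + 2 * a)) by nia.
      now apply IH2.
Qed.

Definition good_below (N : Z) : Prop := forall y, 1 < y < N -> (0 <= slack y)%R.

(* The class [a * w + b], [w >= 0], is reduced along [path] to a number [>= 2];
   if that fails for [w = 0], the number [b] is reduced along [alt] instead,
   unless it is at most [lo]. *)
Definition win_leaf (lo v : Z) (path alt : list Z) (a b : Z) : bool :=
  match path, run path a b with
  | _ :: _, Some (a', b', g, _, _) =>
      (v <=? g) && (0 <=? a') &&
      ((2 <=? b') ||
       (2 <=? a' + b') &&
       ((b <=? lo) ||
        match alt, run alt 0 b with
        | _ :: _, Some (_, y, g', _, _) => (v <=? g') && (2 <=? y)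
        | _, _ => false
        end))
  | _, _ => false
  end.

(** The end of the path is at least 2 and below the start, so [good_below] makes its slack
    nonnegative and the gain remains. Only for [w = 0] can the end drop below 2, whence the case
    distinction on [w]. *)
Lemma win_spec (lo v : Z) (t : tree) (a b : Z) :
  check (win_leaf lo v) t a b = true -> forall w, 0 <= w ->
  lo < a * w + b -> good_below (a * w + b) -> (IZR v <= slack (a * w + b))%R.
Proof.
  revert t a b.
  apply (check_spec (win_leaf lo v)
           (fun x => lo < x -> good_below x -> (IZR v <= slack x)%R)).
  intros path alt a b H w Hw Hlo Hgood. unfold win_leaf in H.
  destruct path as [|p path]; [discriminate|].
  destruct (run (p :: path) a b) as [[[[[a1 b1] g] P] R]|] eqn:E; [|discriminate].
  rewrite !andb_true_iff, orb_true_iff, andb_true_iff, orb_true_iff, !Z.leb_le in H.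
  destruct H as [[Hg Ha] H].
  assert (Hmain : 2 <= a1 * w + b1 -> (IZR v <= slack (a * w + b))%R).
  { intros Hy. apply run_spec in E. destruct E as (HP & HR & HP2 & HE).
    assert (HP2' : 2 <= P) by (apply HP2; discriminate).
    destruct (HE w) as [He Hs]. specialize (Hs ltac:(lia)).
    assert (Hy0 := Hgood (a1 * w + b1) ltac:(nia)).
    apply IZR_le in Hg. lra. }
  destruct H as [H | [Hy H]]; [apply Hmain; nia|].
  destruct (Z.eq_dec w 0) as [-> | Hw0]; [|apply Hmain; nia].
  destruct H as [H | H]; [lia|].
  destruct alt as [|q alt]; [discriminate|].
  destruct (run (q :: alt) 0 b) as [[[[[a2 b2] g2] P2] R2]|] eqn:E2; [|discriminate].
  rewrite andb_true_iff, !Z.leb_le in H. destruct H as [Hg2 Hb2].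
  apply run_spec in E2. destruct E2 as (HP & HR & HP2 & HE).
  assert (HP2' : 2 <= P2) by (apply HP2; discriminate).
  destruct (HE 0) as [He Hs].
  replace (a2 * 0 + b2) with b2 in * by lia.
  replace (0 * 0 + b) with b in * by lia.
  replace (a * 0 + b) with b in * by lia.
  specialize (Hs ltac:(lia)).
  assert (Hy0 := Hgood b2 ltac:(nia)). apply IZR_le in Hg2. lra.
Qed.

(* [Reach N m k D v]: the slack is at least [v] at every positive [x < N] that
   is congruent to [- k / m] modulo [D]. *)
Definition Reach (N m k D v : Z) : Prop :=
  forall x, 0 < x < N -> (D | m * x + k) -> (IZR v <= slack x)%R.

(** The positive multiple [m * x + k] of [D] is at least [2 * m + k], which excludes [x = 1], where
    [good_below] says nothing. *)
Lemma Reach_end (N m k D : Z) : good_below N -> 0 < m -> 0 <= k -> 2 * m + k <= D ->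
  Reach N m k D 0.
Proof.
  intros HN Hm Hk HD x Hx [V HV]. apply HN. split; [|lia].
  destruct (Z.eq_dec x 1); [subst x|lia].
  assert (0 < V) by nia. nia.
Qed.

Lemma Reach_weaken (N m k D D' v v' : Z) :
  (D | D') -> v' <= v -> Reach N m k D v -> Reach N m k D' v'.
Proof.
  intros HD Hv H x Hx Hdiv. apply IZR_le in Hv.
  assert (Hs := H x Hx (Z.divide_trans _ _ _ HD Hdiv)). lra.
Qed.

(* A representative of [- k / m] modulo [D]; [residue_ok] checks that it is one. *)
Definition residue (m k D : Z) : Z :=
  match find (fun u => (D * u - k) mod m =? 0)
             (map Z.of_nat (seq 0 (Z.to_nat m))) with
  | Some u => (D * u - k) / m
  | None => -1
  end.

Definition residue_ok (m k D : Z) : bool :=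
  let x0 := residue m k D in
  (0 <? D) && (0 <? m) && (0 <=? k) && (Z.gcd m D =? 1) && (0 <=? x0) && (x0 <? D)
  && ((m * x0 + k) mod D =? 0).

(** Since [m] is invertible modulo [D], the class has a single residue; the quotient is nonnegative
    because the residue lies in [0, D). *)
Lemma residue_spec (m k D x : Z) : residue_ok m k D = true -> 0 <= x ->
  (D | m * x + k) ->
  exists w, 0 <= w /\ x = D * w + residue m k D.
Proof.
  unfold residue_ok. set (x0 := residue m k D).
  rewrite !andb_true_iff, !Z.ltb_lt, !Z.eqb_eq, !Z.leb_le.
  intros ((((((HD & Hm) & _) & Hg) & H0) & H1) & Hx0) Hx Hdiv.
  apply Zmod_divide in Hx0; [|lia].
  assert (H : (D | m * (x - x0))).
  { replace (m * (x - x0)) with ((m * x + k) - (m * x0 + k)) by ring.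
    now apply Z.divide_sub_r. }
  apply Z.gauss in H; [|now rewrite Z.gcd_comm].
  destruct H as [w Hw]. exists w. split; [nia | lia].
Qed.

(* If [x = P * y + R], then [m * x + k = G * (m' * y + k')], so that division by [P]
   sends the class [- k / m] modulo [D * L] to [- k' / m'] modulo [D' * L]. *)
Definition segment_leaf (m k D m' k' D' v : Z) (path alt : list Z) (a b : Z)
  : bool :=
  match run path a b with
  | Some (_, _, g, P, R) =>
      let G := m * P / m' in
      (v <=? g) && (m * P =? G * m') && (m * R + k =? G * k') && (0 <? G)
      && (D mod (G * D') =? 0) && (0 <? D') && (0 <? m')
  | None => false
  end.

Definition segment_ok (t : tree) (m k D m' k' D' v : Z) : bool :=
  residue_ok m k D
  && check (segment_leaf m k D m' k' D' v) t D (residue m k D).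

(** The check sees only [D], and [L] is carried along: from m x + k = V D L and D = c G D' follows
    m' y + k' = V c D' L. The bound [k' < D' * L] then makes [y] positive. *)
Lemma segment (t : tree) (m k D m' k' D' v N L v' : Z) :
  segment_ok t m k D m' k' D' v = true -> 0 < L -> k' < D' * L ->
  Reach N m' k' (D' * L) v' -> Reach N m k (D * L) (v + v').
Proof.
  intros Hok HL Hk' Hreach x Hx Hdiv.
  apply andb_true_iff in Hok. destruct Hok as [Hres Hok].
  assert (HD : 0 < D /\ 0 < m /\ 0 <= k).
  { unfold residue_ok in Hres.
    rewrite !andb_true_iff, !Z.ltb_lt, !Z.leb_le in Hres. tauto. }
  destruct (residue_spec m k D x Hres ltac:(lia)) as [w [Hw Ex]].
  { apply Z.divide_trans with (2 := Hdiv). exists L; ring. }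
  revert Hx Hdiv. rewrite Ex. clear Ex x Hres.
  refine (check_spec (segment_leaf m k D m' k' D' v)
    (fun x => 0 < x < N -> (D * L | m * x + k) -> (IZR (v + v') <= slack x)%R)
    _ t _ _ Hok w Hw).
  clear t w Hw Hok. intros path alt a b H w _ Hx [V HV].
  unfold segment_leaf in H.
  destruct (run path a b) as [[[[[a1 b1] g] P] R]|] eqn:E; [|discriminate].
  apply run_spec in E. destruct E as (HP & HR & _ & HE).
  destruct (HE w) as [He Hs].
  set (G := m * P / m') in *.
  rewrite !andb_true_iff, !Z.leb_le, !Z.ltb_lt, !Z.eqb_eq in H.
  destruct H as ((((((Hg & HP') & HR') & HG) & Hmod) & HD') & Hm').
  apply Zmod_divide in Hmod; [|nia]. destruct Hmod as [c Hc].
  set (y := a1 * w + b1) in *.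
  assert (Ey : m' * y + k' = V * c * (D' * L)).
  { apply Z.mul_cancel_l with (p := G); [lia|].
    transitivity (m * (a * w + b) + k); [rewrite He; nia|].
    rewrite HV, Hc. ring. }
  assert (HGD : 0 < G * D') by nia.
  assert (Hc0 : 0 < c) by nia.
  assert (HV0 : 0 < V).
  { assert (0 < m * (a * w + b)) by nia. assert (0 < D * L) by nia. nia. }
  assert (Hy : 0 < y).
  { assert (0 < D' * L) by nia. assert (1 <= V * c) by nia. nia. }
  specialize (Hs Hy).
  assert (Hv' := Hreach y ltac:(nia) ltac:(exists (V * c); exact Ey)).
  apply IZR_le in Hg. rewrite plus_IZR. lra.
Qed.

(** A path from a class back to itself uses up one factor [Q] of the modulus, so it can be repeated
    once for each such factor. *)
Lemma segment_iter (t : tree) (m k Q v N L v' n : Z) :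
  segment_ok t m k Q m k 1 v = true -> 0 <= n -> 0 < L -> k < L ->
  Reach N m k L v' -> Reach N m k (Q ^ n * L) (n * v + v').
Proof.
  intros Hok Hn HL Hk HR.
  assert (HQ : 0 < Q).
  { apply andb_true_iff in Hok. destruct Hok as [Hok _]. unfold residue_ok in Hok.
    rewrite !andb_true_iff, !Z.ltb_lt in Hok. tauto. }
  revert n Hn. apply natlike_ind.
  - now rewrite Z.pow_0_r, !Z.mul_1_l.
  - intros n Hn IH. rewrite Z.pow_succ_r, <- Z.mul_assoc by lia.
    replace (Z.succ n * v + v') with (v + (n * v + v')) by ring.
    assert (HQn : 0 < Q ^ n) by (apply Z.pow_pos_nonneg; lia).
    apply (segment t m k Q m k 1); [assumption | nia | nia |].
    now rewrite Z.mul_1_l.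
Qed.

(* [p^e M - 1] is reduced to [M - 1] by [e] steps with the digit [p - 1]; the
   next digit is smaller because [p] does not divide [M]. *)
Lemma escape (N p e M v : Z) :
  is_base p = true -> 0 <= e -> p < M -> ~ (p | M) -> N = p ^ e * M - 1 ->
  (forall r, 0 <= r < p - 1 -> Reach N p (r + 1) M (v - gain p r)) ->
  (IZR (v + e * gain p (p - 1)) <= slack N)%R.
Proof.
  intros Hp He HM HpM HN HR.
  assert (Hp2 : 2 <= p) by (apply is_base_cases in Hp; lia).
  assert (Hpe : 0 < p ^ e) by (apply Z.pow_pos_nonneg; lia).
  assert (Hbase : (IZR v <= slack (M - 1))%R).
  { set (r := (M - 1) mod p). set (y := (M - 1) / p).
    assert (E : M - 1 = p * y + r) by (apply Z.div_mod; lia).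
    assert (Hr : 0 <= r < p) by (apply Z.mod_pos_bound; lia).
    assert (Hr1 : r <> p - 1).
    { intros Hr1. apply HpM. exists (y + 1). lia. }
    assert (Hy : 0 < y) by nia.
    assert (HyN : y < N) by nia.
    assert (H := HR r ltac:(lia) y ltac:(lia) ltac:(exists 1; lia)).
    assert (Hs := slack_step p r y Hp Hr Hy).
    rewrite <- E in Hs. rewrite minus_IZR in H. lra. }
  subst N. clear HR. revert e He Hpe. apply (natlike_ind (fun e => 0 < p ^ e ->
    (IZR (v + e * gain p (p - 1)) <= slack (p ^ e * M - 1))%R)).
  - intros _. rewrite Z.pow_0_r, Z.mul_1_l, Z.mul_0_l, Z.add_0_r. exact Hbase.
  - intros e He IH _.
    assert (Hpe : 0 < p ^ e) by (apply Z.pow_pos_nonneg; lia).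
    specialize (IH Hpe).
    assert (Hs := slack_step p (p - 1) (p ^ e * M - 1) Hp ltac:(lia) ltac:(nia)).
    replace (p * (p ^ e * M - 1) + (p - 1)) with (p ^ Z.succ e * M - 1) in Hs
      by (rewrite Z.pow_succ_r by lia; ring).
    replace (v + Z.succ e * gain p (p - 1))
      with (gain p (p - 1) + (v + e * gain p (p - 1))) by ring.
    rewrite plus_IZR. lra.
Qed.

Lemma win_reach (t : tree) (N m k D v : Z) :
  residue_ok m k D = true -> check (win_leaf 0 v) t D (residue m k D) = true ->
  good_below N -> Reach N m k D v.
Proof.
  intros Hres Hok HN x Hx Hdiv.
  destruct (residue_spec m k D x Hres ltac:(lia) Hdiv) as [w [Hw ->]].
  apply (win_spec 0 v t); [assumption | assumption | lia |].
  intros y Hy. apply HN. lia.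
Qed.

(** * Dividing out a prime power *)

Definition mono (i j k l m n : Z) : Z :=
  2 ^ i * 3 ^ j * 5 ^ k * 7 ^ l * 11 ^ m * 17 ^ n.

Lemma mono_mul (i j k l m n i' j' k' l' m' n' : Z) :
  0 <= i -> 0 <= j -> 0 <= k -> 0 <= l -> 0 <= m -> 0 <= n ->
  0 <= i' -> 0 <= j' -> 0 <= k' -> 0 <= l' -> 0 <= m' -> 0 <= n' ->
  mono i j k l m n * mono i' j' k' l' m' n'
  = mono (i + i') (j + j') (k + k') (l + l') (m + m') (n + n').
Proof. intros. unfold mono. rewrite !Z.pow_add_r by lia. ring. Qed.

Lemma mono_pow (i j k l m n e : Z) :
  0 <= i -> 0 <= j -> 0 <= k -> 0 <= l -> 0 <= m -> 0 <= n -> 0 <= e ->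
  mono i j k l m n ^ e = mono (i * e) (j * e) (k * e) (l * e) (m * e) (n * e).
Proof. intros. unfold mono. rewrite !Z.pow_mul_l, !Z.pow_mul_r by lia. ring. Qed.

Lemma mono_le (i j k l m n i' j' k' l' m' n' : Z) :
  0 <= i <= i' -> 0 <= j <= j' -> 0 <= k <= k' -> 0 <= l <= l' ->
  0 <= m <= m' -> 0 <= n <= n' ->
  0 < mono i j k l m n <= mono i' j' k' l' m' n'.
Proof.
  intros. unfold mono.
  assert (Hp : forall p s t, 0 < p -> 0 <= s <= t -> 0 < p ^ s <= p ^ t).
  { intros p s t Hp Hs. split; [apply Z.pow_pos_nonneg; lia|].
    apply Z.pow_le_mono_r; lia. }
  assert (Hm : forall x y x' y', 0 < x <= x' -> 0 < y <= y' -> 0 < x * y <= x' * y')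
    by (intros; nia).
  repeat apply Hm; apply Hp; lia.
Qed.

(* From each class [- (r + 1) / p] the path [moves[r]] uses the factor [D] of the
   modulus and ends in a class [- k / p] with two periods listed in [cycles], one of
   gain [g1] for each factor [Q1] of the modulus and one of gain [g2] for each [Q2].
   Every path has gain at least [c] once the digit [r] is counted. *)
Definition escape_ok (p D Q1 Q2 c g1 g2 : Z) (moves : list (list Z * Z))
    (cycles : list (Z * list Z * list Z)) : bool :=
  forallb (fun i =>
    let r := Z.of_nat i in
    let (path, k) := nth i moves ([], 0) in
    segment_ok (Leaf path []) p (r + 1) D p k 1 (c - gain p r)
    && (0 <? k) && (k <? p) && (0 <? Q1) && (0 <? Q2)
    && existsb (fun x => let '(k', l1, l2) := x in
         (k' =? k) && segment_ok (Leaf l1 []) p k Q1 p k 1 g1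
         && segment_ok (Leaf l2 []) p k Q2 p k 1 g2) cycles)
  (seq 0 (Z.to_nat (p - 1))).

Lemma escape_reach (N p D Q1 Q2 c g1 g2 : Z) moves cycles :
  escape_ok p D Q1 Q2 c g1 g2 moves cycles = true -> good_below N ->
  forall n1 n2 L r, 0 <= n1 -> 0 <= n2 -> 3 * p <= L -> 0 <= r < p - 1 ->
  Reach N p (r + 1) (D * (Q1 ^ n1 * (Q2 ^ n2 * L)))
    (c - gain p r + (n1 * g1 + (n2 * g2 + 0))).
Proof.
  intros Hok HN n1 n2 L r Hn1 Hn2 HL Hr. unfold escape_ok in Hok.
  rewrite forallb_forall in Hok. specialize (Hok (Z.to_nat r)).
  rewrite in_seq in Hok. specialize (Hok ltac:(lia)).
  rewrite Z2Nat.id in Hok by lia.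
  destruct (nth (Z.to_nat r) moves ([], 0)) as [path k].
  rewrite !andb_true_iff, !Z.ltb_lt in Hok.
  destruct Hok as (((((Hs & Hk0) & Hkp) & HQ1) & HQ2) & Hc).
  apply existsb_exists in Hc. destruct Hc as [[[k' l1] l2] [_ Hc]].
  rewrite !andb_true_iff in Hc. destruct Hc as [[_ Hc1] Hc2].
  assert (0 < Q1 ^ n1) by (apply Z.pow_pos_nonneg; lia).
  assert (0 < Q2 ^ n2) by (apply Z.pow_pos_nonneg; lia).
  assert (L <= Q2 ^ n2 * L) by nia.
  assert (Q2 ^ n2 * L <= Q1 ^ n1 * (Q2 ^ n2 * L)) by nia.
  apply (segment (Leaf path []) p (r + 1) D p k 1); [assumption | lia | lia |].
  rewrite Z.mul_1_l.
  apply (segment_iter (Leaf l1 [])); [assumption | lia | lia | lia |].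
  apply (segment_iter (Leaf l2 [])); [assumption | lia | lia | lia |].
  apply Reach_end; [assumption | lia | lia | lia].
Qed.

Definition first_moves5 : list (list Z * Z) :=
  [([], 1);
   ([2], 1);
   ([2; 2], 2);
   ([2; 2], 1)].

(** A class -k/p is periodic under division by P only if P is 1 modulo p. The products used are 6
    and 16 for 5, 36 and 8 for 7, 12 and 2^10 for 11, 18 and 2^8 for 17. *)
Definition cycles5 : list (Z * list Z * list Z) :=
  [(1, [3; 2], [2; 2; 2; 2]);
   (2, [2; 3], [2; 2; 2; 2]);
   (3, [3; 2], [2; 2; 2; 2])].

Definition first_moves7 : list (list Z * Z) :=
  [([], 1);
   ([2], 1);
   ([3], 1);
   ([2], 2);
   ([3; 2], 2);
   ([3; 2], 1)].

Definition cycles7 : list (Z * list Z * list Z) :=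
  [(1, [2; 2; 3; 3], [2; 2; 2]);
   (2, [3; 3; 2; 2], [2; 2; 2]);
   (4, [2; 3; 3; 2], [2; 2; 2])].

Definition first_moves11 : list (list Z * Z) :=
  [([3; 2; 2; 3; 2; 2], 1);
   ([2; 3; 2; 2; 3; 2; 2], 1);
   ([3; 3; 2; 2; 2; 2], 3);
   ([2; 2; 3; 2; 2; 3; 2], 2);
   ([2; 2; 2; 2; 3; 2], 2);
   ([3; 2; 3; 2; 2; 2; 2], 3);
   ([3; 3; 2; 2; 2], 3);
   ([2; 2; 2; 3; 2; 2; 3], 4);
   ([3; 3; 2; 2], 3);
   ([2; 2; 2; 2; 2; 3], 4)].

Definition cycles11 : list (Z * list Z * list Z) :=
  [(1, [3; 2; 2], [2; 2; 2; 2; 2; 2; 2; 2; 2; 2]);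
   (2, [2; 3; 2], [2; 2; 2; 2; 2; 2; 2; 2; 2; 2]);
   (3, [3; 2; 2], [2; 2; 2; 2; 2; 2; 2; 2; 2; 2]);
   (4, [2; 2; 3], [2; 2; 2; 2; 2; 2; 2; 2; 2; 2]);
   (6, [3; 2; 2], [2; 2; 2; 2; 2; 2; 2; 2; 2; 2])].

Definition first_moves17 : list (list Z * Z) :=
  [([3; 3; 2], 1);
   ([2; 3; 3; 2], 1);
   ([3; 3; 2], 3);
   ([2; 2; 3; 3; 2], 1);
   ([2; 2; 2; 3; 2; 2; 2; 3], 6);
   ([3; 2; 3; 2], 3);
   ([3; 2; 2; 2; 3; 2], 3);
   ([2; 2; 2; 3; 3; 2], 1);
   ([3; 3], 1);
   ([2; 2; 2; 2; 3; 2; 2], 2);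
   ([2; 2; 3; 2; 2; 2; 3; 2], 3);
   ([3; 2; 2; 3; 2], 3);
   ([2; 2; 2; 2; 2; 2; 3; 3], 2);
   ([2; 3; 2; 2; 2; 3; 2], 3);
   ([2; 2; 2; 2; 2; 3; 3; 2], 1);
   ([2; 2; 2; 2; 3; 3; 2], 1)].

Definition cycles17 : list (Z * list Z * list Z) :=
  [(1, [3; 3; 2], [2; 2; 2; 2; 2; 2; 2; 2]);
   (2, [2; 3; 3], [2; 2; 2; 2; 2; 2; 2; 2]);
   (3, [3; 3; 2], [2; 2; 2; 2; 2; 2; 2; 2]);
   (6, [3; 2; 3], [2; 2; 2; 2; 2; 2; 2; 2]);
   (9, [3; 3; 2], [2; 2; 2; 2; 2; 2; 2; 2])].

(** * Bounds from dividing out a power of each of the six primes *)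

Definition factored (N a b c d e f w : Z) : Prop :=
  0 <= a /\ 0 <= b /\ 0 <= c /\ 0 <= d /\ 0 <= e /\ 0 <= f /\ 0 < w /\
  N + 1 = mono a b c d e f * w /\
  forall p, is_base p = true -> ~ (p | w).

Lemma is_base_prime (p : Z) : is_base p = true -> prime p.
Proof.
  intros Hp. apply is_base_cases in Hp. apply prime_alt. split; [lia|].
  intros n Hn [q Hq].
  assert (Hc : n = 2 \/ n = 3 \/ n = 4 \/ n = 5 \/ n = 6 \/ n = 7 \/ n = 8 \/ n = 9
    \/ n = 10 \/ n = 11 \/ n = 12 \/ n = 13 \/ n = 14 \/ n = 15 \/ n = 16) by lia.
  repeat (destruct Hc as [-> | Hc]); try subst n; lia.
Qed.

Lemma not_divide_pow (p q e : Z) : is_base p = true -> is_base q = true ->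
  p <> q -> 0 <= e -> ~ (p | q ^ e).
Proof.
  intros Hp Hq Hpq He H. apply Hpq.
  apply (prime_power_prime p q e He); auto using is_base_prime.
Qed.

Lemma not_divide_mul (p x y : Z) : is_base p = true ->
  ~ (p | x) -> ~ (p | y) -> ~ (p | x * y).
Proof.
  intros Hp Hx Hy H. apply prime_mult in H; [tauto | now apply is_base_prime].
Qed.

Ltac not_divide :=
  unfold mono; rewrite ?Z.pow_0_r, ?Z.mul_1_l, ?Z.mul_1_r;
  repeat (apply not_divide_mul; [reflexivity | |]);
  first [ apply not_divide_pow; [reflexivity | reflexivity | lia | lia]
        | auto ].

Ltac mono_eq :=
  repeat rewrite mono_pow by lia;
  rewrite ?Z.mul_assoc;
  repeat rewrite mono_mul by lia;
  f_equal; unfold mono; do 6 (f_equal; try lia).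

Lemma mono_large (x0 i j k l m n i' j' k' l' m' n' w : Z) :
  x0 <= mono i' j' k' l' m' n' -> 0 < w ->
  0 <= i' <= i -> 0 <= j' <= j -> 0 <= k' <= k -> 0 <= l' <= l ->
  0 <= m' <= m -> 0 <= n' <= n ->
  x0 <= mono i j k l m n * w.
Proof.
  intros. assert (H' := mono_le i' j' k' l' m' n' i j k l m n). nia.
Qed.

Lemma strip_bound (N p e M D Q1 Q2 c g1 g2 : Z) moves cycles (n1 n2 L : Z) :
  escape_ok p D Q1 Q2 c g1 g2 moves cycles = true -> good_below N ->
  is_base p = true -> 0 <= e -> p < M -> ~ (p | M) -> N = p ^ e * M - 1 ->
  D * (Q1 ^ n1 * (Q2 ^ n2 * L)) = M -> 3 * p <= L -> 0 <= n1 -> 0 <= n2 ->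
  (IZR (c + g1 * n1 + g2 * n2 + gain p (p - 1) * e) <= slack N)%R.
Proof.
  intros Hok HN Hp He HpM HM EN EM HL Hn1 Hn2.
  replace (c + g1 * n1 + g2 * n2 + gain p (p - 1) * e)
    with (c + g1 * n1 + g2 * n2 + e * gain p (p - 1)) by ring.
  apply (escape N p e M); [assumption.. |].
  intros r Hr.
  replace (c + g1 * n1 + g2 * n2 - gain p r)
    with (c - gain p r + (n1 * g1 + (n2 * g2 + 0))) by ring.
  rewrite <- EM. now apply (escape_reach N p D Q1 Q2 c g1 g2 moves cycles).
Qed.

Ltac split_factored H :=
  let Ha := fresh "Ha" in let Hb := fresh "Hb" in let Hc := fresh "Hc" in
  let Hd := fresh "Hd" in let He := fresh "He" in let Hf := fresh "Hf" in
  let Hw := fresh "Hw" in let HN := fresh "HN" in let Hnd := fresh "Hnd" in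
  destruct H as (Ha & Hb & Hc & Hd & He & Hf & Hw & HN & Hnd).

Ltac factor_out HN :=
  match goal with |- ?N = _ =>
    replace N with (N + 1 - 1) by ring; rewrite HN; f_equal; unfold mono;
    rewrite Z.pow_0_r; ring end.

(** Each of the [c] digits 4 costs 29576, and the periods 6 and 16 earn 7269 and 4092. If the slack
    is negative, this bounds [c] from below. The 6 in the bound on [a] is 2 for the first path and 4
    for a leftover factor 16 >= 3 * 5. *)
Lemma strip5 (N a b c d e f w n1 n2 : Z) :
  factored N a b c d e f w -> good_below N -> 0 <= n1 -> 0 <= n2 ->
  n1 + 4 * n2 + 6 <= a -> n1 <= b ->
  (IZR (- 7530 + 7269 * n1 + 4092 * n2 + - 29576 * c) <= slack N)%R.
Proof.
  intros HF Hgood Hn1 Hn2 H1 H2. split_factored HF.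
  change (- 29576) with (gain 5 (5 - 1)).
  apply (strip_bound N 5 c (mono a b 0 d e f * w) 4 6 16 (- 7530) 7269 4092
    first_moves5 cycles5 n1 n2 (mono (a - 2 - n1 - 4 * n2) (b - n1) 0 d e f * w));
    [vm_compute; reflexivity | assumption | reflexivity | lia | | not_divide
    | factor_out HN | | | lia | lia].
  - apply Z.lt_le_trans with 64; [lia|].
    apply mono_large with 6 0 0 0 0 0; try lia; reflexivity.
  - change 4 with (mono 2 0 0 0 0 0) at 1. change 6 with (mono 1 1 0 0 0 0).
    change 16 with (mono 4 0 0 0 0 0). mono_eq.
  - apply mono_large with 4 0 0 0 0 0; try lia; discriminate.
Qed.

(** Here and for 11 and 17 the exponents assumed positive provide the leftover factor: 8 * 5, 5 * 7
    and 5 * 7 * 11 exceed 3 * 7, 3 * 11 and 3 * 17. *)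
Lemma strip7 (N a b c d e f w n1 n2 : Z) :
  factored N a b c d e f w -> good_below N -> 0 <= n1 -> 0 <= n2 -> 1 <= c ->
  2 * n1 + 3 * n2 + 4 <= a -> 2 * n1 + 1 <= b ->
  (IZR (- 19674 + 14538 * n1 + 8069 * n2 + - 36943 * d) <= slack N)%R.
Proof.
  intros HF Hgood Hn1 Hn2 Hc1 H1 H2. split_factored HF.
  change (- 36943) with (gain 7 (7 - 1)).
  apply (strip_bound N 7 d (mono a b c 0 e f * w) 6 36 8 (- 19674) 14538 8069
    first_moves7 cycles7 n1 n2
    (mono (a - 1 - 2 * n1 - 3 * n2) (b - 1 - 2 * n1) c 0 e f * w));
    [vm_compute; reflexivity | assumption | reflexivity | lia | | not_divide
    | factor_out HN | | | lia | lia].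
  - apply Z.lt_le_trans with 80; [lia|].
    apply mono_large with 4 0 1 0 0 0; try lia; reflexivity.
  - change 6 with (mono 1 1 0 0 0 0). change 36 with (mono 2 2 0 0 0 0).
    change 8 with (mono 3 0 0 0 0 0). mono_eq.
  - apply mono_large with 3 0 1 0 0 0; try lia; discriminate.
Qed.

Lemma strip11 (N a b c d e f w n1 n2 : Z) :
  factored N a b c d e f w -> good_below N -> 0 <= n1 -> 0 <= n2 ->
  1 <= c -> 1 <= d -> 2 * n1 + 10 * n2 + 5 <= a -> n1 + 2 <= b ->
  (IZR (- 28613 + 13292 * n1 + 10230 * n2 + - 59974 * e) <= slack N)%R.
Proof.
  intros HF Hgood Hn1 Hn2 Hc1 Hd1 H1 H2. split_factored HF.
  change (- 59974) with (gain 11 (11 - 1)).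
  apply (strip_bound N 11 e (mono a b c d 0 f * w) 288 12 1024 (- 28613) 13292
    10230 first_moves11 cycles11 n1 n2
    (mono (a - 5 - 2 * n1 - 10 * n2) (b - 2 - n1) c d 0 f * w));
    [vm_compute; reflexivity | assumption | reflexivity | lia | | not_divide
    | factor_out HN | | | lia | lia].
  - apply Z.lt_le_trans with 32; [lia|].
    apply mono_large with 5 0 0 0 0 0; try lia; reflexivity.
  - change 288 with (mono 5 2 0 0 0 0). change 12 with (mono 2 1 0 0 0 0).
    change 1024 with (mono 10 0 0 0 0 0). mono_eq.
  - apply mono_large with 0 0 1 1 0 0; try lia; discriminate.
Qed.

Lemma strip17 (N a b c d e f w n1 n2 : Z) :
  factored N a b c d e f w -> good_below N -> 0 <= n1 -> 0 <= n2 ->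
  1 <= c -> 1 <= d -> 1 <= e -> n1 + 8 * n2 + 6 <= a -> 2 * n1 + 2 <= b ->
  (IZR (- 33069 + 18515 * n1 + 8184 * n2 + - 63630 * f) <= slack N)%R.
Proof.
  intros HF Hgood Hn1 Hn2 Hc1 Hd1 He1 H1 H2. split_factored HF.
  change (- 63630) with (gain 17 (17 - 1)).
  apply (strip_bound N 17 f (mono a b c d e 0 * w) 576 18 256 (- 33069) 18515
    8184 first_moves17 cycles17 n1 n2
    (mono (a - 6 - n1 - 8 * n2) (b - 2 - 2 * n1) c d e 0 * w));
    [vm_compute; reflexivity | assumption | reflexivity | lia | | not_divide
    | factor_out HN | | | lia | lia].
  - apply Z.lt_le_trans with 64; [lia|].
    apply mono_large with 6 0 0 0 0 0; try lia; reflexivity.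
  - change 576 with (mono 6 2 0 0 0 0). change 18 with (mono 1 2 0 0 0 0).
    change 256 with (mono 8 0 0 0 0 0). mono_eq.
  - apply mono_large with 0 0 1 1 1 0; try lia; discriminate.
Qed.

(** After [a] digits 1 at a cost of 3977 each, the next digit can only be 0; it gains 6023 and leads
    to the class -1/2. *)
Lemma strip2 (N a b c d e f w D v : Z) :
  factored N a b c d e f w -> good_below N -> 2 <= b -> 1 <= a ->
  (D | mono 0 b c d e f * w) -> Reach N 2 1 D v ->
  (IZR (6023 + v + - 3977 * a) <= slack N)%R.
Proof.
  intros HF Hgood Hb2 Ha1 HD HR. split_factored HF.
  replace (6023 + v + - 3977 * a) with (6023 + v + a * gain 2 (2 - 1))
    by (change (gain 2 (2 - 1)) with (- 3977); ring).
  apply (escape N 2 a (mono 0 b c d e f * w));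
    [reflexivity | lia | | not_divide | factor_out HN |].
  - apply Z.lt_le_trans with 9; [lia|].
    apply mono_large with 0 2 0 0 0 0; try lia; reflexivity.
  - intros r Hr. replace r with 0 by lia.
    apply (Reach_weaken _ _ _ D _ v); [assumption | | exact HR].
    change (gain 2 0) with 6023. lia.
Qed.

(** After the digits 2, the digit 0 leads to -1/3 directly. The digit 1 leads to -2/3, and an exact
    halving goes on to -1/3; this takes the extra factor 2 of the modulus and gains 1246 + 6023 =
    7269 in all. *)
Lemma strip3 (N a b c d e f w D v : Z) :
  factored N a b c d e f w -> good_below N -> 2 <= a -> 2 < D ->
  (2 * D | mono a 0 c d e f * w) -> Reach N 3 1 D v ->
  (IZR (7269 + v + - 8754 * b) <= slack N)%R.
Proof.
  intros HF Hgood Ha2 HD2 HD HR. split_factored HF.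
  replace (7269 + v + - 8754 * b) with (7269 + v + b * gain 3 (3 - 1))
    by (change (gain 3 (3 - 1)) with (- 8754); ring).
  apply (escape N 3 b (mono a 0 c d e f * w));
    [reflexivity | lia | | not_divide | factor_out HN |].
  - apply Z.lt_le_trans with 4; [lia|].
    apply mono_large with 2 0 0 0 0 0; try lia; reflexivity.
  - intros r Hr. assert (Hc' : r = 0 \/ r = 1) by lia.
    destruct Hc' as [-> | ->].
    + apply (Reach_weaken _ _ _ D _ v); [| | exact HR].
      * apply Z.divide_trans with (2 := HD). exists 2. ring.
      * change (gain 3 0) with 11246. lia.
    + apply (Reach_weaken _ _ _ (2 * D) _ (6023 + v)); [assumption | |].
      * change (gain 3 1) with 1246. lia.
      * apply (segment (Leaf [2] []) 3 2 2 3 1 1); [reflexivity | lia | lia |].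
        now rewrite Z.mul_1_l.
Qed.

(** * Long chains from the classes -1/2 and -1/3 *)

Ltac iterate t := apply (segment_iter t); [reflexivity | lia | lia | lia |].

Ltac climb t m k := apply (segment t _ _ _ m k 1); [reflexivity | lia | lia |];
  rewrite Z.mul_1_l.

Lemma strip2_short (N a b c d e f w t s : Z) :
  factored N a b c d e f w -> good_below N -> 1 <= a -> 2 <= b -> 2 <= c -> 1 <= d ->
  0 <= t -> 0 <= s -> t + 2 * s + 1 <= b ->
  (IZR (18069 + 1246 * t + 12492 * s + - 3977 * a) <= slack N)%R.
Proof.
  intros HF Hgood Ha1 Hb2 Hc2 Hd1 Ht Hs Hts.
  assert (HF' := HF). split_factored HF'.
  set (L := mono 0 (b - 1 - t - 2 * s) (c - 1) d e f * w).
  (* The chain ends in the class -1/8, where [Reach_end] asks for 2 * 8 + 1. *)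
  assert (HL : 17 <= L)
    by (apply mono_large with 0 0 1 1 0 0; try lia; discriminate).
  replace (18069 + 1246 * t + 12492 * s)
    with (6023 + (t * 1246 + (6023 + (6023 + (s * 12492 + 0))))) by ring.
  apply (strip2 N a b c d e f w (3 ^ t * (3 * (5 * (9 ^ s * L))))); try assumption.
  - exists 1. rewrite Z.mul_1_l. unfold L.
    change 3 with (mono 0 1 0 0 0 0) at 1 2. change 5 with (mono 0 0 1 0 0 0).
    change 9 with (mono 0 2 0 0 0 0). symmetry. mono_eq.
  - assert (0 < 9 ^ s) by (apply Z.pow_pos_nonneg; lia).
    assert (L <= 9 ^ s * L) by nia.
    iterate (Leaf [3] []).
    (* To double the denominator, an even number is halved. For an odd one the digit 1 is paid for
       by an exact division by 3 (by 5 in the next line), so 6023 is gained in both cases. *)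
    climb (Learn2 (Leaf [2; 3] []) (Leaf [2] [])) 4 1.
    climb (Learn2 (Leaf [2; 5] []) (Leaf [2] [])) 8 1.
    iterate (Leaf [3; 3] []).
    apply Reach_end; [assumption | lia | lia | lia].
Qed.

Lemma strip2_long (N a b c d e f w t s r u : Z) :
  factored N a b c d e f w -> good_below N -> 1 <= a ->
  0 <= t -> 0 <= s -> 0 <= r -> 0 <= u ->
  t + 2 * s + 3 <= b -> r + 1 <= f -> u + 1 <= c -> u <= d -> u <= e ->
  65 <= mono 0 0 (c - 1 - u) (d - u) (e - u) 0 ->
  (IZR (30115 + 1246 * t + 12492 * s + 6370 * r + 13507 * u + - 3977 * a)
   <= slack N)%R.
Proof.
  intros HF Hgood Ha1 Ht Hs Hr Hu Hts Hrf Huc Hud Hue Hlarge.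
  assert (HF' := HF). split_factored HF'.
  set (L := mono 0 (b - 3 - t - 2 * s) (c - 1 - u) (d - u) (e - u) (f - 1 - r) * w).
  assert (HL : 65 <= L)
    by (apply mono_large with 0 0 (c - 1 - u) (d - u) (e - u) 0; lia).
  replace (30115 + 1246 * t + 12492 * s + 6370 * r + 13507 * u)
    with (6023 + (t * 1246 + (6023 + (6023 + (s * 12492 + (6023
          + (r * 6370 + (6023 + (u * 13507 + 0))))))))) by ring.
  apply (strip2 N a b c d e f w
    (3 ^ t * (3 * (5 * (9 ^ s * (9 * (17 ^ r * (17 * (385 ^ u * L))))))))); try lia;
    try assumption.
  - exists 1. rewrite Z.mul_1_l. unfold L.
    change 3 with (mono 0 1 0 0 0 0) at 1 2. change 5 with (mono 0 0 1 0 0 0).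
    change 9 with (mono 0 2 0 0 0 0). change 17 with (mono 0 0 0 0 0 1).
    change 385 with (mono 0 0 1 1 1 0). symmetry. mono_eq.
  - assert (0 < 9 ^ s) by (apply Z.pow_pos_nonneg; lia).
    assert (0 < 17 ^ r) by (apply Z.pow_pos_nonneg; lia).
    assert (0 < 385 ^ u) by (apply Z.pow_pos_nonneg; lia).
    assert (L <= 385 ^ u * L) by nia.
    set (L1 := 385 ^ u * L) in *.
    assert (17 * L1 <= 17 ^ r * (17 * L1)) by nia.
    set (L2 := 17 ^ r * (17 * L1)) in *.
    assert (9 * L2 <= 9 ^ s * (9 * L2)) by nia.
    set (L3 := 9 ^ s * (9 * L2)) in *.
    iterate (Leaf [3] []).
    climb (Learn2 (Leaf [2; 3] []) (Leaf [2] [])) 4 1.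
    climb (Learn2 (Leaf [2; 5] []) (Leaf [2] [])) 8 1.
    unfold L3. iterate (Leaf [3; 3] []).
    climb (Learn2 (Leaf [2; 3; 3] []) (Leaf [2] [])) 16 1.
    unfold L2. iterate (Leaf [17] []).
    climb (Learn2 (Leaf [2; 17] []) (Leaf [2] [])) 32 1.
    (* As 385 = 12 * 32 + 1, the residue is 12, with digits 1, 1, 0 at 11, 5, 7 and gain 26 + 424 +
       13057. *)
    unfold L1. iterate (Leaf [11; 5; 7] []).
    apply Reach_end; [assumption | lia | lia | lia].
Qed.

(** The constant 7 counts the factors 2 in the extra 2 of [strip3], in 80 and in 100. A reserve of
    [z] factors 2, together with the powers of 11, keeps the last modulus at least 55 = 2 * 27 +
    1. *)
Lemma strip3_long (N a b c d e f w n4 n10 n28 n136 z : Z) :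
  factored N a b c d e f w -> good_below N ->
  0 <= n4 -> 0 <= n10 -> 0 <= n28 -> 0 <= n136 -> 0 <= z ->
  7 + 2 * n4 + n10 + 2 * n28 + 3 * n136 + z <= a ->
  3 + n10 <= c -> n28 <= d -> n136 <= f -> 55 <= mono z 0 0 0 e 0 ->
  (IZR (33853 + 2046 * n4 + 6447 * n10 + 15103 * n28 + 14439 * n136 + - 8754 * b)
   <= slack N)%R.
Proof.
  intros HF Hgood H4 H10 H28 H136 Hz HA HC HD HFf Hlarge.
  assert (HF' := HF). split_factored HF'.
  set (L := mono (a - 7 - 2 * n4 - n10 - 2 * n28 - 3 * n136) 0 (c - 3 - n10)
              (d - n28) e (f - n136) * w).
  assert (HL : 55 <= L)
    by (apply mono_large with z 0 0 0 e 0; lia).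
  replace (33853 + 2046 * n4 + 6447 * n10 + 15103 * n28 + 14439 * n136)
    with (7269 + (n4 * 2046 + (15338 + (n10 * 6447 + (11246
          + (n28 * 15103 + (n136 * 14439 + 0))))))) by ring.
  assert (0 < 4 ^ n4) by (apply Z.pow_pos_nonneg; lia).
  assert (0 < 10 ^ n10) by (apply Z.pow_pos_nonneg; lia).
  assert (0 < 28 ^ n28) by (apply Z.pow_pos_nonneg; lia).
  assert (0 < 136 ^ n136) by (apply Z.pow_pos_nonneg; lia).
  assert (L <= 136 ^ n136 * L) by nia.
  set (L1 := 136 ^ n136 * L) in *.
  assert (L1 <= 28 ^ n28 * L1) by nia.
  set (L2 := 28 ^ n28 * L1) in *.
  assert (100 * L2 <= 10 ^ n10 * (100 * L2)) by nia.
  set (L3 := 10 ^ n10 * (100 * L2)) in *.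
  assert (80 * L3 <= 4 ^ n4 * (80 * L3)) by nia.
  apply (strip3 N a b c d e f w (4 ^ n4 * (80 * L3))); try lia; try assumption.
  - exists 1. rewrite Z.mul_1_l. unfold L3, L2, L1, L.
    change 2 with (mono 1 0 0 0 0 0) at 1.
    change 4 with (mono 2 0 0 0 0 0). change 80 with (mono 4 0 1 0 0 0).
    change 10 with (mono 1 0 1 0 0 0). change 100 with (mono 2 0 2 0 0 0).
    change 28 with (mono 2 0 0 1 0 0). change 136 with (mono 3 0 0 0 0 1).
    symmetry. mono_eq.
  - iterate (Leaf [2; 2] []).
    (* The three paths use up the factors 16, 40 and 10, with least common multiple 80. In the climb
       to -1/27 they use 100, 1 and 10. *)
    climb (Learn3 (Leaf [2; 2; 2; 2; 3] []) (Leaf [2; 2; 3; 2; 5] [])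
             (Leaf [3; 2; 5] [])) 9 1.
    unfold L3. iterate (Leaf [2; 5] []).
    climb (Learn3 (Leaf [2; 5; 2; 3; 5] []) (Leaf [3] []) (Leaf [2; 3; 5] [])) 27 1.
    unfold L2. iterate (Leaf [2; 2; 7] []).
    unfold L1. iterate (Leaf [2; 2; 2; 17] []).
    apply Reach_end; [assumption | lia | lia | lia].
Qed.

(** * Small exponents of 2, 3 and 5 *)

(* [trees_q_p] treats the [N] for which [(N + 1) / q] is an integer prime to [p]. *)
Definition trees_12_2 : list tree :=
  [Learn2
      (Learn2
        (Leaf [2; 2; 2; 2; 2] [])
        (Leaf [2; 2; 2; 2; 3] [2; 2; 7]))
      (Leaf [2; 2; 2; 2] [])].

Definition trees_24_2 : list tree :=
  [Learn2
      (Learn2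
        (Learn2
          (Leaf [2; 2; 2; 2; 2; 2; 2] [])
          (Leaf [2; 2; 2; 2; 2; 3] []))
        (Leaf [2; 2; 2; 2; 2; 3] [7]))
      (Leaf [2; 2; 2; 2; 2] [])].

Definition trees_24_3 : list tree :=
  [Learn3
      (Leaf [2; 3; 3; 2; 2] [])
      (Leaf [2; 3; 3; 2; 2] [5])
      (Leaf [2; 3; 3; 3] []);
   Leaf [3; 3] []].

Definition trees_288_3 : list tree :=
  [Learn3
      (Learn3
        (Leaf [2; 3; 3; 3; 2; 2; 2; 2; 3] [7])
        (Leaf [2; 3; 3; 3; 2; 2; 2; 2; 3] [3; 7])
        (Leaf [2; 3; 3; 3; 2; 2; 2; 2; 3] []))
      (Leaf [2; 3; 3; 3; 3] [])
      (Leaf [2; 3; 3; 3; 2; 2; 3] []);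
   Learn3
      (Leaf [3; 3; 3; 3] [])
      (Leaf [3; 3; 3; 2; 2; 2; 3] [])
      (Leaf [3; 3; 3; 2; 2; 3] [])].

Definition trees_144_5 : list tree :=
  [Leaf [2; 2; 5] [];
   Leaf [3; 5] [];
   Leaf [2; 5] [];
   Leaf [5] []].

Definition trees_720_2 : list tree :=
  [Learn2
      (Learn2
        (Leaf [2; 2; 2; 2; 2; 2; 2; 5] [2; 3; 7])
        (Leaf [2; 2; 2; 2; 2; 2; 2] []))
      (Learn2
        (Leaf [2; 2; 2; 2; 2; 2; 3; 2; 5] [2; 2; 7])
        (Leaf [2; 2; 2; 2; 2; 2; 2; 3] []))].

Definition trees_4320_2 : list tree :=
  [Learn2
      (Learn2
        (Leaf [2; 2; 2; 2; 2; 2; 2; 3; 2; 5; 3] [7])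
        (Leaf [2; 2; 2; 2; 2; 2; 2; 2; 3; 3] []))
      (Learn2
        (Leaf [2; 2; 2; 2; 2; 2; 2; 2; 5; 3; 3] [7; 2; 5; 5])
        (Leaf [2; 2; 2; 2; 2; 2; 2; 2; 3; 3] []))].

Definition trees_8640_2 : list tree :=
  [Learn2
      (Learn2
        (Learn2
          (Leaf [2; 2; 2; 2; 2; 2; 2; 2; 3; 2; 5; 2; 3] [2; 7])
          (Leaf [2; 2; 2; 2; 2; 2; 2; 2; 3; 2; 2; 5] []))
        (Leaf [2; 2; 2; 2; 2; 2; 2; 2; 2; 3; 3; 3] []))
      (Learn2
        (Leaf [2; 2; 2; 2; 2; 2; 2; 2; 2; 5; 3; 3] [2; 7; 2; 5; 5])
        (Leaf [2; 2; 2; 2; 2; 2; 2; 2; 2; 3; 3] []))].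

Definition trees_17280_2 : list tree :=
  [Learn2
      (Learn2
        (Learn2
          (Learn2
            (Leaf [2; 2; 2; 2; 2; 2; 2; 2; 2; 3; 2; 5; 2; 2; 3] [2; 2; 7])
            (Leaf [2; 2; 2; 2; 2; 2; 2; 2; 2; 3; 2; 5; 3; 3] []))
          (Leaf [2; 2; 2; 2; 2; 2; 2; 2; 2; 3; 2; 5; 3; 3] [7]))
        (Leaf [2; 2; 2; 2; 2; 2; 2; 2; 2; 2; 3; 3; 3] []))
      (Learn2
        (Leaf [2; 2; 2; 2; 2; 2; 2; 2; 2; 2; 5; 3; 3] [2; 2; 7; 2; 5; 5])
        (Leaf [2; 2; 2; 2; 2; 2; 2; 2; 2; 2; 3; 3] []))].

Definition trees_103680_2 : list tree :=
  [Learn2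
      (Learn2
        (Leaf [2; 2; 2; 2; 2; 2; 2; 2; 2; 2; 2; 5; 3; 3; 3] [7; 2; 5; 2; 2])
        (Leaf [2; 2; 2; 2; 2; 2; 2; 2; 2; 2; 2; 3; 3; 3; 3] []))
      (Learn2
        (Leaf [2; 2; 2; 2; 2; 2; 2; 2; 2; 2; 3; 2; 5; 3; 3] [2; 7])
        (Leaf [2; 2; 2; 2; 2; 2; 2; 2; 2; 2; 2; 3; 3; 3; 3] []))].

Definition trees_34560_3 : list tree :=
  [Learn3
      (Learn3
        (Leaf [2; 3; 3; 3; 3; 3; 2; 5; 2; 3] [7])
        (Leaf [2; 3; 3; 3; 3; 3; 3] [])
        (Leaf [2; 3; 3; 3; 3; 3; 2; 3; 2; 2] []))
      (Leaf [2; 3; 3; 3; 3; 2; 2; 3; 2; 5] [])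
      (Leaf [2; 3; 3; 3; 3; 2; 2; 2; 2; 3; 2; 5] []);
   Learn3
      (Leaf [3; 3; 3; 3; 2; 2; 3; 2; 5] [])
      (Leaf [3; 3; 3; 3; 2; 2; 2; 2; 2; 2; 3] [])
      (Leaf [3; 3; 3; 3; 2; 2; 2; 2; 3] [])].

Definition trees_207360_3 : list tree :=
  [Learn3
      (Learn3
        (Leaf [3; 3; 3; 3; 3; 2; 2; 3; 2; 5; 2; 3] [3; 7; 3; 3])
        (Leaf [3; 3; 3; 3; 3; 2; 2; 3; 3] [])
        (Leaf [3; 3; 3; 3; 3; 2; 2; 3; 2; 3; 2; 2; 2] []))
      (Learn3
        (Leaf [3; 3; 3; 3; 3; 2; 2; 2; 2; 3; 2; 5; 2; 3] [3; 7])
        (Leaf [3; 3; 3; 3; 3; 2; 2; 2; 2; 3; 3] [])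
        (Leaf [3; 3; 3; 3; 3; 2; 2; 2; 2; 3; 2; 3; 2; 2] []))
      (Leaf [3; 3; 3; 3; 3; 2; 2; 2; 2; 2; 2; 3; 2; 5] []);
   Learn3
      (Learn3
        (Leaf [2; 3; 3; 3; 3; 3; 2; 2; 3; 2; 5; 2; 3; 2; 2] [2; 3; 7; 3; 3])
        (Leaf [2; 3; 3; 3; 3; 3; 2; 2; 3; 2; 3; 2; 2; 2] [])
        (Learn3
          (Leaf [2; 3; 3; 3; 3; 3; 2; 2; 3; 3; 3] [])
          (Leaf [2; 3; 3; 3; 3; 3; 2; 2; 3; 3; 2; 2; 2; 3] [])
          (Leaf [2; 3; 3; 3; 3; 3; 2; 2; 3; 3; 2; 2; 3] [])))
      (Learn3
        (Learn3
          (Leaf [2; 3; 3; 3; 3; 3; 3; 3; 3] [])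
          (Leaf [2; 3; 3; 3; 3; 3; 3; 3; 2; 2; 2; 3] [])
          (Leaf [2; 3; 3; 3; 3; 3; 3; 3; 2; 2; 3] []))
        (Leaf [2; 3; 3; 3; 3; 3; 3; 2; 5; 2; 3; 2; 2; 2] [])
        (Leaf [2; 3; 3; 3; 3; 3; 3; 2; 3; 2; 2; 2; 2] []))
      (Learn3
        (Leaf [2; 3; 3; 3; 3; 3; 2; 2; 2; 2; 3; 2; 5; 2; 3] [3; 7; 3; 3])
        (Leaf [2; 3; 3; 3; 3; 3; 2; 2; 2; 2; 3; 2; 3; 5] [])
        (Leaf [2; 3; 3; 3; 3; 3; 2; 2; 2; 2; 3; 3; 2; 2] []))].

(* The class [- 1 / 2] modulo [3 ^ 5 * 5 * 7]. *)
Definition binary_5 : tree :=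
  Learn2
      (Learn2
        (Leaf [2; 2; 3; 3; 3; 3; 3] [])
        (Leaf [2; 2; 5; 3; 3; 3; 3; 3] []))
      (Learn2
        (Leaf [2; 2; 3; 3; 3; 3; 3] [])
        (Leaf [2; 3; 2; 5; 3; 3; 3; 3] [])).

(* [ternary_b] treats the class [- 1 / 3] modulo a product of powers of 2, 5, 7 and 11,
   with a gain that pays for the removal of [3 ^ b]. *)
Definition ternary_5 : tree :=
  Learn3
      (Learn3
        (Leaf [2; 2; 3; 2; 5; 2; 3; 2; 2; 2; 2] [])
        (Leaf [2; 2; 3; 3; 2; 2; 7] [])
        (Leaf [2; 2; 3; 2; 3; 2; 2; 2; 2; 2] []))
      (Learn3
        (Leaf [2; 2; 2; 2; 3; 2; 5; 2; 3; 2; 2; 2] [])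
        (Leaf [2; 2; 2; 2; 3; 3; 2; 2; 7] [])
        (Leaf [2; 2; 2; 2; 3; 2; 3; 2; 2; 2; 2] []))
      (Learn3
        (Leaf [3; 2; 5; 2; 3; 2; 2; 2; 2] [])
        (Leaf [3; 3; 2; 2; 7] [])
        (Leaf [3; 2; 3; 2; 2; 2; 2; 2] [])).

Definition ternary_6 : tree :=
  Learn3
      (Learn3
        (Leaf [2; 2; 3; 2; 5; 2; 5; 2; 3; 2; 2; 2; 2] [])
        (Leaf [2; 2; 3; 2; 5; 2; 3; 2; 2; 2; 2; 2] [])
        (Leaf [2; 2; 3; 2; 3; 2; 2; 2; 2; 2; 2; 2; 7] []))
      (Learn3
        (Leaf [3; 2; 3; 2; 2; 2; 2; 2; 2; 2; 7] [])
        (Leaf [3; 2; 5; 2; 5; 2; 3; 2; 2; 2; 2] [])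
        (Leaf [3; 2; 5; 2; 3; 2; 2; 2; 2; 2; 2; 2] []))
      (Learn3
        (Leaf [2; 2; 2; 2; 3; 2; 5; 2; 5; 2; 3; 2; 2; 2; 2] [])
        (Leaf [2; 2; 2; 2; 3; 2; 5; 2; 3; 5; 2; 2; 7] [])
        (Leaf [2; 2; 2; 2; 3; 2; 3; 2; 2; 2; 2; 2; 2; 7] [])).

Definition ternary_7 : tree :=
  Learn3
      (Learn3
        (Leaf [2; 2; 2; 2; 3; 2; 5; 2; 3; 2; 2; 2; 2; 2; 2; 2; 7] [])
        (Leaf [2; 2; 2; 2; 3; 2; 5; 2; 5; 2; 3; 2; 2; 2; 2; 2] [])
        (Leaf [2; 2; 2; 2; 3; 2; 3; 2; 2; 2; 2; 2; 2; 2; 7] []))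
      (Learn3
        (Leaf [3; 2; 5; 2; 5; 2; 3; 2; 2; 2; 2; 2; 2; 2; 7] [])
        (Leaf [3; 2; 3; 2; 2; 2; 2; 2; 2; 2; 2; 2; 2; 11; 2; 2; 7] [])
        (Leaf [3; 2; 5; 2; 3; 2; 2; 2; 2; 2; 2; 2; 2; 2; 2; 11] []))
      (Learn3
        (Leaf [2; 2; 3; 2; 5; 2; 3; 2; 2; 2; 2; 2; 2; 2; 7] [])
        (Leaf [2; 2; 3; 2; 5; 2; 5; 2; 3; 2; 2; 2; 2; 2; 2; 2] [])
        (Leaf [2; 2; 3; 2; 3; 2; 2; 2; 2; 2; 2; 2; 7] [])).

Definition ternary_8 : tree :=
  Learn3
      (Learn3
        (Leaf [3; 2; 5; 2; 5; 2; 3; 2; 2; 2; 2; 2; 2; 2; 7] [])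
        (Leaf [3; 2; 5; 2; 3; 2; 2; 2; 2; 2; 2; 2; 2; 2; 2; 11; 2; 2; 7] [])
        (Leaf [3; 2; 3; 2; 2; 2; 2; 2; 2; 2; 2; 2; 2; 11; 2; 2; 7] []))
      (Learn3
        (Leaf [2; 2; 2; 2; 3; 2; 5; 2; 5; 2; 3; 2; 2; 2; 2; 2; 2; 2; 7] [])
        (Leaf [2; 2; 2; 2; 3; 2; 5; 2; 3; 2; 2; 2; 2; 2; 2; 2; 7] [])
        (Learn3
          (Leaf [2; 2; 2; 2; 3; 2; 3; 2; 2; 2; 2; 2; 2; 2; 7; 2; 3] [])
          (Leaf [2; 2; 2; 2; 3; 2; 3; 2; 2; 2; 2; 2; 2; 2; 3; 2; 11; 5; 2; 7] [])
          (Leaf [2; 2; 2; 2; 3; 2; 3; 5; 2; 2; 7; 2; 2; 3; 2; 2] [])))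
      (Learn3
        (Leaf [2; 2; 3; 2; 5; 2; 5; 2; 3; 2; 2; 2; 2; 2; 2; 2; 7] [])
        (Leaf [2; 2; 3; 2; 5; 2; 3; 2; 2; 2; 2; 2; 2; 2; 7; 2; 2] [])
        (Learn3
          (Leaf [2; 2; 3; 2; 3; 2; 2; 2; 2; 2; 2; 2; 7; 2; 2; 3] [])
          (Leaf [2; 2; 3; 2; 3; 2; 2; 2; 2; 2; 2; 2; 3; 2; 2; 2; 11] [])
          (Leaf [2; 2; 3; 2; 3; 5; 2; 2; 7; 2; 2; 3; 2; 2; 2] []))).

Definition ternary_9 : tree :=
  Learn3
      (Learn3
        (Leaf [3; 2; 5; 2; 5; 2; 3; 2; 2; 2; 2; 2; 2; 2; 7; 2; 2; 7] [])
        (Leaf [2; 2; 2; 2; 2; 2; 3; 2; 5; 2; 5; 2; 3; 2; 2; 2; 2; 2; 2; 2; 7] [])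
        (Leaf [3; 2; 5; 2; 3; 2; 2; 2; 2; 2; 2; 2; 2; 2; 2; 11; 2; 2; 7; 2; 2] []))
      (Learn3
        (Leaf [2; 2; 3; 2; 5; 2; 5; 2; 3; 2; 2; 2; 2; 2; 2; 2; 7; 2; 2; 7] [])
        (Leaf [2; 2; 3; 2; 3; 2; 2; 2; 2; 2; 2; 2; 2; 2; 2; 11; 2; 2; 7; 2; 2; 7] [])
        (Leaf [2; 2; 3; 2; 5; 2; 3; 2; 2; 2; 2; 2; 2; 2; 2; 2; 2; 11; 2; 2; 7] []))
      (Learn3
        (Leaf [2; 2; 2; 2; 3; 2; 5; 2; 3; 2; 2; 2; 2; 2; 2; 2; 7; 2; 2; 7] [])
        (Leaf [2; 2; 2; 2; 3; 2; 5; 2; 5; 2; 3; 2; 2; 2; 2; 2; 2; 2; 7; 2; 2] [])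
        (Leaf [2; 2; 2; 2; 3; 2; 3; 2; 2; 2; 2; 2; 2; 2; 7; 2; 2; 7] [])).

Definition ternary_10 : tree :=
  Learn3
      (Learn3
        (Leaf [3; 2; 5; 2; 5; 2; 5; 2; 3; 2; 2; 2; 2; 2; 2; 2; 7; 2; 2; 7] [])
        (Leaf [3; 2; 5; 2; 5; 2; 3; 2; 2; 2; 2; 2; 2; 2; 2; 2; 2; 11; 2; 2; 7; 2; 2;
           7] [])
        (Leaf [3; 2; 5; 2; 3; 2; 2; 2; 2; 2; 2; 2; 2; 2; 2; 11; 2; 2; 7; 2; 2; 7] []))
      (Learn3
        (Leaf [2; 2; 2; 2; 3; 2; 5; 2; 5; 2; 5; 2; 3; 2; 2; 2; 2; 2; 2; 2; 7; 2; 2;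
           7] [])
        (Leaf [2; 2; 2; 2; 3; 2; 5; 2; 5; 2; 3; 2; 2; 2; 2; 2; 2; 2; 7; 2; 2; 7] [])
        (Leaf [2; 2; 2; 2; 3; 2; 5; 2; 3; 2; 2; 2; 2; 2; 2; 2; 7; 2; 2; 7; 5; 11; 2;
           2] []))
      (Learn3
        (Leaf [2; 2; 3; 2; 5; 2; 5; 2; 5; 2; 3; 2; 2; 2; 2; 2; 2; 2; 7; 2; 2; 7] [])
        (Leaf [2; 2; 3; 2; 5; 2; 5; 2; 3; 2; 2; 2; 2; 2; 2; 2; 7; 2; 2; 7] [])
        (Leaf [2; 2; 3; 2; 5; 2; 3; 2; 2; 2; 2; 2; 2; 2; 2; 2; 2; 11; 2; 2; 7; 2; 7]
           [])).

(* Every residue class [alpha * (q * w + i) - 1] with [0 < i < q] is handled by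
   the corresponding tree. *)
Definition class_ok (alpha q : Z) (ts : list tree) : bool :=
  forallb (fun i => check (win_leaf 23 0) (nth (i - 1) ts (Leaf [] []))
                      (q * alpha) (Z.of_nat i * alpha - 1))
          (seq 1 (Z.to_nat (q - 1))).

(** The nonzero residue of [W] modulo [q] selects the tree. Numbers up to 23 are exempt in
    [win_leaf], which matches [23 < N]. *)
Lemma class_win (alpha q : Z) (ts : list tree) (N W : Z) :
  class_ok alpha q ts = true -> 1 < q -> 23 < N -> good_below N ->
  N + 1 = alpha * W -> 0 < W -> ~ (q | W) -> (0 <= slack N)%R.
Proof.
  intros Hok Hq HN Hgood HW HW0 HqW. unfold class_ok in Hok.
  rewrite forallb_forall in Hok.
  assert (Hb := Z.mod_pos_bound W q ltac:(lia)).
  assert (E := Z.div_mod W q ltac:(lia)).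
  assert (Hi : W mod q <> 0) by (intros Hi; apply HqW, Zmod_divide; lia).
  assert (Hw : 0 <= W / q) by (apply Z.div_pos; lia).
  specialize (Hok (Z.to_nat (W mod q))). rewrite in_seq, Z2Nat.id in Hok by lia.
  specialize (Hok ltac:(lia)).
  assert (EN : N = q * alpha * (W / q) + (W mod q * alpha - 1)) by nia.
  rewrite EN. apply (win_spec 23 0 _ _ _ Hok); [assumption | lia |].
  now rewrite <- EN.
Qed.

(** * Numbers other than -1 modulo 12, and numbers up to 23 *)

Lemma slack_nonneg_mod12 (N : Z) : 23 < N -> good_below N ->
  N mod 12 <> 11 -> (0 <= slack N)%R.
Proof.
  intros HN Hgood H11.
  (* One step with digit 0, or with digit 1 at 3, already gains. Only the class of 5 takes two
     steps, with digits 1 and 0 at 2. *)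
  assert (Hok : class_ok 1 12
    [Leaf [2] []; Leaf [3] []; Leaf [2] []; Leaf [3] []; Leaf [2] []; Leaf [2; 2] [];
     Leaf [2] []; Leaf [3] []; Leaf [2] []; Leaf [3] []; Leaf [2] []] = true)
    by (vm_compute; reflexivity).
  apply (class_win 1 12 _ N (N + 1) Hok); try lia; try assumption.
  intros [v Hv]. apply H11. symmetry. apply (Z.mod_unique_pos N 12 (v - 1)); lia.
Qed.

Lemma slack_base (p : Z) : is_base p = true -> (0 <= slack p)%R.
Proof.
  intros Hp. assert (Hw := weight_spec p Hp).
  assert (Hc : 1 <= p <= 17) by (apply is_base_cases in Hp; lia).
  assert (Hcost := cost_spec p Hc).
  assert (Hle : 10000 * cost p <= weight p).
  { apply is_base_cases in Hp.
    repeat (destruct Hp as [-> | Hp]); try subst p; discriminate. }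
  apply IZR_le in Hcost, Hle. rewrite <- INR_IZR_INZ in Hcost.
  rewrite mult_IZR in Hle. unfold slack. lra.
Qed.

Lemma slack_nonneg_small (N : Z) : 1 < N <= 23 -> good_below N -> (0 <= slack N)%R.
Proof.
  intros HN Hgood.
  assert (Hs : forall p r y, is_base p = true -> 0 <= r < p -> 1 < y ->
    0 <= gain p r -> N = p * y + r -> (0 <= slack N)%R).
  { intros p r y Hp Hr Hy Hg ->.
    assert (H := slack_step p r y Hp Hr ltac:(lia)).
    assert (Hp2 : 2 <= p) by (apply is_base_cases in Hp; lia).
    assert (Hy' := Hgood y ltac:(nia)). apply IZR_le in Hg. lra. }
  assert (Hc : N = 2 \/ N = 3 \/ N = 5 \/ N = 7 \/ N = 11 \/ N = 17 \/ N = 23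
    \/ N mod 2 = 0 /\ 4 <= N \/ N = 9 \/ N = 13 \/ N = 15 \/ N = 19 \/ N = 21).
  { assert (Hm := Z.mod_pos_bound N 2 ltac:(lia)).
    assert (E := Z.div_mod N 2 ltac:(lia)). lia. }
  repeat match type of Hc with _ \/ _ => destruct Hc as [Hc | Hc] end;
    try (apply slack_base; subst N; reflexivity).
  (* The step 23 = 2 * 11 + 1 loses 3977, which the slack of 11, at least 90026 - 80000, covers. *)
  - assert (H := slack_step 2 1 11 eq_refl ltac:(lia) ltac:(lia)).
    assert (Hw := weight_spec 11 eq_refl). assert (Hc11 := cost_spec 11 ltac:(lia)).
    apply IZR_le in Hc11. rewrite <- INR_IZR_INZ in Hc11.
    subst N. change (2 * 11 + 1) with 23 in H.
    change (gain 2 1) with (- 3977) in H. change (weight 11) with 90026 in Hw.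
    change (cost 11) with 8 in Hc11. unfold slack in H at 1. lra.
  - apply (Hs 2 0 (N / 2)); try reflexivity; try lia.
    + assert (E := Z.div_mod N 2 ltac:(lia)). lia.
    + discriminate.
    + assert (E := Z.div_mod N 2 ltac:(lia)). lia.
  - apply (Hs 3 0 3); try reflexivity; try lia; discriminate.
  - apply (Hs 3 1 4); try reflexivity; try lia; discriminate.
  - apply (Hs 3 0 5); try reflexivity; try lia; discriminate.
  - apply (Hs 3 1 6); try reflexivity; try lia; discriminate.
  - apply (Hs 3 0 7); try reflexivity; try lia; discriminate.
Qed.

Lemma valuation (p x : Z) : 1 < p -> 0 < x ->
  exists e y, 0 <= e /\ 0 < y /\ x = p ^ e * y /\ ~ (p | y).
Proof.
  intros Hp Hx. assert (Hx0 : 0 <= x) by lia. revert Hx. pattern x.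
  apply Z_lt_induction; [|exact Hx0]. clear x Hx0.
  intros x IH Hx. destruct (Zdivide_dec p x) as [[y Hy] | Hd].
  - destruct (IH y ltac:(nia) ltac:(nia)) as (e & z & He & Hz & Ey & Hd).
    exists (Z.succ e), z. rewrite Z.pow_succ_r by lia.
    repeat split; [lia | lia | nia | assumption].
  - exists 0, x. rewrite Z.pow_0_r. repeat split; [lia | lia | lia | assumption].
Qed.

Lemma factored_exists (N : Z) : 0 < N ->
  exists a b c d e f w, factored N a b c d e f w.
Proof.
  intros HN.
  destruct (valuation 2 (N + 1) ltac:(lia) ltac:(lia)) as (a & x1 & Ha & H1 & E1 & D1).
  destruct (valuation 3 x1 ltac:(lia) H1) as (b & x2 & Hb & H2 & E2 & D2).
  destruct (valuation 5 x2 ltac:(lia) H2) as (c & x3 & Hc & H3 & E3 & D3).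
  destruct (valuation 7 x3 ltac:(lia) H3) as (d & x4 & Hd & H4 & E4 & D4).
  destruct (valuation 11 x4 ltac:(lia) H4) as (e & x5 & He & H5 & E5 & D5).
  destruct (valuation 17 x5 ltac:(lia) H5) as (f & w & Hf & Hw & E6 & D6).
  exists a, b, c, d, e, f, w. unfold factored, mono. do 7 (split; [assumption|]). split.
  - rewrite E1, E2, E3, E4, E5, E6. ring.
  - intros p Hp Hpw. apply is_base_cases in Hp.
    repeat (destruct Hp as [-> | Hp]); try subst p; [apply D1 | apply D2 | apply D3
      | apply D4 | apply D5 | apply D6]; subst; repeat apply Z.divide_mul_r; assumption.
Qed.

Lemma mono_divide (i j k l m n i' j' k' l' m' n' D w : Z) :
  D = mono i' j' k' l' m' n' -> 0 <= i' <= i -> 0 <= j' <= j -> 0 <= k' <= k ->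
  0 <= l' <= l -> 0 <= m' <= m -> 0 <= n' <= n -> (D | mono i j k l m n * w).
Proof.
  intros -> H1 H2 H3 H4 H5 H6. apply Z.divide_mul_l.
  exists (mono (i - i') (j - j') (k - k') (l - l') (m - m') (n - n')).
  rewrite mono_mul by lia. f_equal; lia.
Qed.

Lemma factored_class (N a b c d e f w alpha q a' b' c' : Z) (ts : list tree) :
  factored N a b c d e f w -> good_below N -> 23 < N ->
  class_ok alpha q ts = true -> alpha = mono a' b' c' 0 0 0 -> 1 < q ->
  0 <= a' <= a -> 0 <= b' <= b -> 0 <= c' <= c ->
  ~ (q | mono (a - a') (b - b') (c - c') d e f * w) -> (0 <= slack N)%R.
Proof.
  intros HF Hgood HN Hok Ealpha Hq Ha' Hb' Hc' Hnd. split_factored HF.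
  apply (class_win alpha q ts N (mono (a - a') (b - b') (c - c') d e f * w));
    try assumption.
  - rewrite HN0, Ealpha, Z.mul_assoc, mono_mul by lia. f_equal. f_equal; lia.
  - assert (H := mono_large 1 (a - a') (b - b') (c - c') d e f 0 0 0 0 0 0 w).
    change (mono 0 0 0 0 0 0) with 1 in H. lia.
Qed.

Ltac by_class HF q a b c ts :=
  apply (factored_class _ _ _ _ _ _ _ _ (mono a b c 0 0 0) q a b c ts HF);
  [assumption | assumption | vm_compute; reflexivity | reflexivity | lia | lia | lia
  | lia | split_factored HF;
          repeat match goal with |- context [?x - ?y] =>
            replace (x - y) with 0 by lia end; not_divide].

(** Each case fixes one exponent, so that the cofactor is prime to [q]; the cases already excluded
    supply the other factors of the modulus. The order of the cases therefore matters. *)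
Lemma slack_nonneg_small_exponents (N a b c d e f w : Z) :
  factored N a b c d e f w -> good_below N -> 23 < N -> 2 <= a -> 1 <= b ->
  a <= 7 \/ b <= 4 \/ c = 0 -> (0 <= slack N)%R.
Proof.
  intros HF Hgood HN Ha Hb Hab.
  assert (Hc : 0 <= c) by (split_factored HF; lia).
  destruct (Z.eq_dec a 2) as [-> | Ha2]; [by_class HF 2 2 1 0 trees_12_2|].
  destruct (Z.eq_dec a 3) as [-> | Ha3]; [by_class HF 2 3 1 0 trees_24_2|].
  destruct (Z.eq_dec b 1) as [-> | Hb1]; [by_class HF 3 3 1 0 trees_24_3|].
  destruct (Z.eq_dec c 0) as [-> | Hc0]; [by_class HF 5 4 2 0 trees_144_5|].
  destruct (Z.eq_dec a 4) as [-> | Ha4]; [by_class HF 2 4 2 1 trees_720_2|].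
  destruct (Z.eq_dec b 2) as [-> | Hb2]; [by_class HF 3 5 2 0 trees_288_3|].
  destruct (Z.eq_dec a 5) as [-> | Ha5]; [by_class HF 2 5 3 1 trees_4320_2|].
  destruct (Z.eq_dec a 6) as [-> | Ha6]; [by_class HF 2 6 3 1 trees_8640_2|].
  destruct (Z.eq_dec a 7) as [-> | Ha7]; [by_class HF 2 7 3 1 trees_17280_2|].
  destruct (Z.eq_dec b 3) as [-> | Hb3]; [by_class HF 3 8 3 1 trees_34560_3|].
  destruct (Z.eq_dec b 4) as [-> | Hb4]; [|lia].
  destruct (Z.eq_dec a 8) as [-> | Ha8]; [by_class HF 2 8 4 1 trees_103680_2|].
  by_class HF 3 9 4 1 trees_207360_3.
Qed.

(** * The remaining exponents *)

Lemma neg_bound (N v : Z) :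
  (IZR v <= slack N)%R -> (slack N < 0)%R -> v < 0.
Proof. intros Hv H. apply lt_IZR. lra. Qed.

(** For small exponents a fixed finite tree replaces the periodic chain from -1/2; its gain [v]
    forces [a] to be large at negative slack. *)
Lemma strip2_win (N a b c d e f w D b' c' d' v : Z) (t : tree) :
  factored N a b c d e f w -> good_below N -> (slack N < 0)%R ->
  1 <= a -> 2 <= b -> 0 <= b' <= b -> 0 <= c' <= c -> 0 <= d' <= d ->
  D = mono 0 b' c' d' 0 0 ->
  residue_ok 2 1 D = true -> check (win_leaf 0 v) t D (residue 2 1 D) = true ->
  6023 + v < 3977 * a.
Proof.
  intros HF Hgood Hneg Ha Hb Hb' Hc' Hd' HD Hres Hok.
  assert (H : 6023 + v + - 3977 * a < 0); [|lia].
  apply (neg_bound N); [|assumption].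
  apply (strip2 N a b c d e f w D); try assumption.
  - split_factored HF. now apply mono_divide with 0 b' c' d' 0 0; try lia.
  - now apply (win_reach t).
Qed.

(** The counterpart for -1/3. The inequality [a' < a] is strict because [strip3] takes one more
    factor 2. *)
Lemma strip3_win (N a b c d e f w D a' c' d' e' v : Z) (t : tree) :
  factored N a b c d e f w -> good_below N -> (slack N < 0)%R ->
  2 <= a' < a -> 0 <= c' <= c -> 0 <= d' <= d -> 0 <= e' <= e ->
  D = mono a' 0 c' d' e' 0 ->
  residue_ok 3 1 D = true -> check (win_leaf 0 v) t D (residue 3 1 D) = true ->
  7269 + v < 8754 * b.
Proof.
  intros HF Hgood Hneg Ha Hc' Hd' He' HD Hres Hok.
  assert (H : 7269 + v + - 8754 * b < 0); [|lia].
  apply (neg_bound N); [|assumption].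
  assert (H2 := mono_le 2 0 0 0 0 0 a' 0 c' d' e' 0).
  change (mono 2 0 0 0 0 0) with 4 in H2.
  apply (strip3 N a b c d e f w D); try assumption; try lia.
  - split_factored HF. apply mono_divide with (a' + 1) 0 c' d' e' 0; try lia.
    rewrite HD. change 2 with (mono 1 0 0 0 0 0). rewrite mono_mul by lia. f_equal; lia.
  - now apply (win_reach t).
Qed.

Ltac by_strip3 HF a c d e v t :=
  let H := fresh in
  assert (H := fun HD => strip3_win _ _ _ _ _ _ _ _ (mono a 0 c d e 0) a c d e v t HF
    ltac:(assumption) ltac:(assumption) ltac:(lia) ltac:(lia) ltac:(lia) ltac:(lia) HD
    ltac:(vm_compute; reflexivity) ltac:(vm_compute; reflexivity));
  specialize (H eq_refl); lia.

Ltac use H := apply neg_bound in H; [|assumption].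

Lemma medium_exponents (N a b c d e f w : Z) :
  factored N a b c d e f w -> good_below N -> (slack N < 0)%R ->
  8 <= a -> 5 <= b <= 10 -> 1 <= c -> False.
Proof.
  intros HF Hgood Hneg Ha Hb Hc.
  assert (He0 : 0 <= e) by (split_factored HF; lia).
  assert (Hd : 1 <= d).
  { assert (H := strip7 N a b c d e f w 2 0 HF Hgood ltac:(lia) ltac:(lia)
      ltac:(lia) ltac:(lia) ltac:(lia)). use H. lia. }
  (* The gain 3977 * 11 - 6023 pays for up to eleven digits 1, so [a] must exceed 11. *)
  destruct (Z_le_gt_dec a 11) as [Ha11 | Ha11].
  { assert (H := strip2_win N a b c d e f w (mono 0 5 1 1 0 0) 5 1 1
      (3977 * 11 - 6023) binary_5 HF Hgood Hneg ltac:(lia) ltac:(lia) ltac:(lia)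
      ltac:(lia) ltac:(lia) eq_refl ltac:(vm_compute; reflexivity)
      ltac:(vm_compute; reflexivity)). lia. }
  (* With the gain 8754 * b - 7269 the conclusion of [strip3_win] becomes 8754 * b < 8754 * b;
     likewise for each later value of [b]. *)
  destruct (Z.eq_dec b 5) as [-> | Hb5];
    [by_strip3 HF 11 1 1 0 (8754 * 5 - 7269) ternary_5|].
  assert (Hc2 : 2 <= c).
  { assert (H := strip5 N a b c d e f w 6 0 HF Hgood ltac:(lia) ltac:(lia)
      ltac:(lia) ltac:(lia)). use H. lia. }
  destruct (Z.eq_dec b 6) as [-> | Hb6];
    [by_strip3 HF 11 2 1 0 (8754 * 6 - 7269) ternary_6|].
  (* These lower bounds for [a] provide the factors 2 that the trees from [ternary_7] on use. *)
  assert (Hs : forall t s, 0 <= t -> 0 <= s -> t + 2 * s + 1 <= b ->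
    18069 + 1246 * t + 12492 * s < 3977 * a).
  { intros t s Ht Hs Hts. assert (H := strip2_short N a b c d e f w t s HF Hgood
      ltac:(lia) ltac:(lia) Hc2 Hd Ht Hs Hts). use H. lia. }
  assert (He : 14 <= a -> 1 <= e).
  { intros Ha14. assert (H := strip11 N a b c d e f w 4 0 HF Hgood ltac:(lia)
      ltac:(lia) ltac:(lia) ltac:(lia) ltac:(lia) ltac:(lia)). use H. lia. }
  destruct (Z.eq_dec b 7) as [-> | Hb7].
  { specialize (Hs 0 3). by_strip3 HF 13 2 1 1 (8754 * 7 - 7269) ternary_7. }
  destruct (Z.eq_dec b 8) as [-> | Hb8].
  { specialize (Hs 1 3). by_strip3 HF 14 2 1 1 (8754 * 8 - 7269) ternary_8. }
  assert (Hs9 := Hs 0 4).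
  assert (Hd2 : 2 <= d).
  { assert (H := strip7 N a b c d e f w 4 2 HF Hgood ltac:(lia) ltac:(lia)
      ltac:(lia) ltac:(lia) ltac:(lia)). use H. lia. }
  destruct (Z.eq_dec b 9) as [-> | Hb9];
    [by_strip3 HF 17 2 2 1 (8754 * 9 - 7269) ternary_9|].
  assert (b = 10) by lia. subst b.
  assert (Hc3 : 3 <= c).
  { assert (H := strip5 N a 10 c d e f w 10 0 HF Hgood ltac:(lia) ltac:(lia)
      ltac:(lia) ltac:(lia)). use H. lia. }
  by_strip3 HF 17 3 2 1 (8754 * 10 - 7269) ternary_10.
Qed.

Lemma div_bounds (x m : Z) : 0 < m -> m * (x / m) <= x < m * (x / m) + m.
Proof.
  intros Hm. assert (E := Z.div_mod x m ltac:(lia)).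
  assert (H := Z.mod_pos_bound x m Hm). lia.
Qed.

Lemma mono_11_large (z e : Z) : 0 <= z -> 2 <= e \/ 3 <= z /\ 1 <= e ->
  55 <= mono z 0 0 0 e 0.
Proof.
  intros Hz [He | [Hz3 He]].
  - assert (H := mono_le 0 0 0 0 2 0 z 0 0 0 e 0).
    change (mono 0 0 0 0 2 0) with 121 in H. lia.
  - assert (H := mono_le 3 0 0 0 1 0 z 0 0 0 e 0).
    change (mono 3 0 0 0 1 0) with 88 in H. lia.
Qed.

(** The order is forced: the bound for each prime rests on the smaller ones among 5, 7 and 11
    already dividing N + 1. *)
Lemma first_exponents (N a b c d e f w : Z) :
  factored N a b c d e f w -> good_below N -> (slack N < 0)%R ->
  12 <= a -> 11 <= b -> 2 <= c /\ 1 <= d /\ 1 <= e /\ 1 <= f.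
Proof.
  intros HF Hgood Hneg Ha Hb.
  assert (Hc : 2 <= c).
  { assert (H := strip5 N a b c d e f w 6 0 HF Hgood ltac:(lia) ltac:(lia)
      ltac:(lia) ltac:(lia)). use H. lia. }
  assert (Hd : 1 <= d).
  { assert (H := strip7 N a b c d e f w 2 0 HF Hgood ltac:(lia) ltac:(lia)
      ltac:(lia) ltac:(lia) ltac:(lia)). use H. lia. }
  assert (He : 1 <= e).
  { assert (H := strip11 N a b c d e f w 3 0 HF Hgood ltac:(lia)
      ltac:(lia) ltac:(lia) ltac:(lia) ltac:(lia) ltac:(lia)). use H. lia. }
  assert (Hf : 1 <= f).
  { assert (H := strip17 N a b c d e f w 4 0 HF Hgood ltac:(lia)
      ltac:(lia) ltac:(lia) ltac:(lia) ltac:(lia) ltac:(lia) ltac:(lia)).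
    use H. lia. }
  lia.
Qed.

(** [strip2_short] bounds [a] below, the primes 5 to 17 give bounds for [c], [d], [e], [f] linear in
    [a] and [b], and with these the gain of [strip2_long] exceeds 3977 * a. *)
Lemma large_exponents_low (N a b c d e f w : Z) :
  factored N a b c d e f w -> good_below N -> (slack N < 0)%R ->
  12 <= a -> 50 <= b -> 4 * a <= 9 * b -> False.
Proof.
  intros HF Hgood Hneg Ha Hb Hab.
  destruct (first_exponents N a b c d e f w HF Hgood Hneg ltac:(lia) ltac:(lia))
    as (Hc & Hd & He & Hf).
  assert (D1 := div_bounds (b - 1) 2 ltac:(lia)).
  assert (HS := strip2_short N a b c d e f w 0 ((b - 1) / 2) HF Hgood
    ltac:(lia) ltac:(lia) Hc Hd ltac:(lia) ltac:(lia) ltac:(lia)). use HS.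
  assert (D5 := div_bounds (a - 6 - b) 4 ltac:(lia)).
  assert (H5 := strip5 N a b c d e f w b ((a - 6 - b) / 4) HF Hgood
    ltac:(lia) ltac:(lia) ltac:(lia) ltac:(lia)). use H5.
  assert (D7 := div_bounds (a - 4 - 2 * ((b - 1) / 2)) 3 ltac:(lia)).
  assert (H7 := strip7 N a b c d e f w ((b - 1) / 2)
    ((a - 4 - 2 * ((b - 1) / 2)) / 3) HF Hgood
    ltac:(lia) ltac:(lia) ltac:(lia) ltac:(lia) ltac:(lia)). use H7.
  assert (D11 := div_bounds (a - 5) 2 ltac:(lia)).
  assert (H11 := strip11 N a b c d e f w (Z.min ((a - 5) / 2) (b - 2)) 0 HF Hgood
    ltac:(lia) ltac:(lia) ltac:(lia) ltac:(lia) ltac:(lia) ltac:(lia)). use H11.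
  assert (D2 := div_bounds (b - 2) 2 ltac:(lia)).
  assert (D17 := div_bounds (a - 6 - (b - 2) / 2) 8 ltac:(lia)).
  assert (H17 := strip17 N a b c d e f w ((b - 2) / 2) ((a - 6 - (b - 2) / 2) / 8)
    HF Hgood ltac:(lia) ltac:(lia) ltac:(lia) ltac:(lia) ltac:(lia) ltac:(lia)
    ltac:(lia)). use H17.
  assert (D3 := div_bounds (b - 3) 2 ltac:(lia)).
  (* The number of divisions by 385 is as large as possible, but two factors 11 are kept: 121 >=
     65. *)
  assert (Hu : exists u, 0 <= u /\ u <= c - 1 /\ u <= d /\ u <= e - 2 /\
    (u = c - 1 \/ u = d \/ u = e - 2)).
  { exists (Z.min (c - 1) (Z.min d (e - 2))). lia. }
  destruct Hu as (u & Hu0 & Hu1 & Hu2 & Hu3 & Hu4).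
  assert (HL : 65 <= mono 0 0 (c - 1 - u) (d - u) (e - u) 0).
  { assert (H := mono_le 0 0 0 0 2 0 0 0 (c - 1 - u) (d - u) (e - u) 0).
    change (mono 0 0 0 0 2 0) with 121 in H. lia. }
  assert (HB := strip2_long N a b c d e f w 0 ((b - 3) / 2) (f - 1) u HF Hgood
    ltac:(lia) ltac:(lia) ltac:(lia) ltac:(lia) ltac:(lia) ltac:(lia) ltac:(lia)
    ltac:(lia) ltac:(lia) ltac:(lia) HL). use HB.
  destruct Hu4 as [-> | [-> | ->]]; lia.
Qed.

(** The chains spend at most about 9 b / 4 factors 2, so the bounds for the other exponents, and the
    gain of [strip3_long] set against 8754 * b, depend on [b] only. *)
Lemma large_exponents_high (N a b c d e f w : Z) :
  factored N a b c d e f w -> good_below N -> (slack N < 0)%R ->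
  12 <= a -> 50 <= b -> 9 * b < 4 * a -> False.
Proof.
  intros HF Hgood Hneg Ha Hb Hab.
  destruct (first_exponents N a b c d e f w HF Hgood Hneg ltac:(lia) ltac:(lia))
    as (Hc & Hd & He & Hf).
  assert (D5 := div_bounds (5 * b - 24) 16 ltac:(lia)).
  assert (H5 := strip5 N a b c d e f w b ((5 * b - 24) / 16) HF Hgood
    ltac:(lia) ltac:(lia) ltac:(lia) ltac:(lia)). use H5.
  assert (D1 := div_bounds (b - 1) 2 ltac:(lia)).
  assert (D7 := div_bounds (5 * b - 12) 12 ltac:(lia)).
  assert (H7 := strip7 N a b c d e f w ((b - 1) / 2) ((5 * b - 12) / 12) HF Hgood
    ltac:(lia) ltac:(lia) ltac:(lia) ltac:(lia) ltac:(lia)). use H7.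
  assert (H11 := strip11 N a b c d e f w (b - 2) 0 HF Hgood
    ltac:(lia) ltac:(lia) ltac:(lia) ltac:(lia) ltac:(lia) ltac:(lia)). use H11.
  assert (D2 := div_bounds (b - 2) 2 ltac:(lia)).
  assert (D17 := div_bounds (7 * b - 20) 32 ltac:(lia)).
  assert (H17 := strip17 N a b c d e f w ((b - 2) / 2) ((7 * b - 20) / 32)
    HF Hgood ltac:(lia) ltac:(lia) ltac:(lia) ltac:(lia) ltac:(lia) ltac:(lia)
    ltac:(lia)). use H17.
  (* The shares of the factors 2 for the periods 4, 10, 28 and 136 are 0.8 b - 7, 0.3 b, 0.6 b and
     0.54 b. With the constant 7 they add up to 2.24 b, below 9 b / 4. *)
  assert (E1 := div_bounds (3 * b) 10 ltac:(lia)).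
  assert (E2 := div_bounds (9 * b) 50 ltac:(lia)).
  assert (E3 := div_bounds (8 * b - 70) 20 ltac:(lia)).
  assert (HT := strip3_long N a b c d e f w ((8 * b - 70) / 20)
    (Z.min (c - 3) (3 * b / 10)) (Z.min d (3 * b / 10)) (Z.min f (9 * b / 50)) 0
    HF Hgood ltac:(lia) ltac:(lia) ltac:(lia) ltac:(lia) ltac:(lia) ltac:(lia)
    ltac:(lia) ltac:(lia) ltac:(lia)
    (mono_11_large 0 e ltac:(lia) ltac:(lia))). use HT.
  lia.
Qed.

(** * Computed bounds for 11 <= b < 50 *)

Definition least_above (h s : Z) : Z := if h <? 0 then 0 else h / s + 1.

Lemma least_above_le (h s x : Z) : 0 < s -> 0 <= x -> h + - s * x < 0 ->
  least_above h s <= x.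
Proof.
  intros Hs Hx H. unfold least_above. destruct (Z.ltb_spec h 0); [lia|].
  assert (D := div_bounds h s Hs). nia.
Qed.

(** In all four bounds [n1] is as large as possible, since the first period gains more per factor 2;
    the remaining factors 2 go to the second. *)
Definition min_c (a b : Z) : Z :=
  let n1 := Z.min (a - 6) b in
  least_above (- 7530 + 7269 * n1 + 4092 * ((a - 6 - n1) / 4)) 29576.

Definition min_d (a b : Z) : Z :=
  let n1 := Z.min ((a - 4) / 2) ((b - 1) / 2) in
  least_above (- 19674 + 14538 * n1 + 8069 * ((a - 4 - 2 * n1) / 3)) 36943.

Definition min_e (a b : Z) : Z :=
  let n1 := Z.min ((a - 5) / 2) (b - 2) in
  least_above (- 28613 + 13292 * n1 + 10230 * ((a - 5 - 2 * n1) / 10)) 59974.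

Definition min_f (a b : Z) : Z :=
  let n1 := Z.min (a - 6) ((b - 2) / 2) in
  least_above (- 33069 + 18515 * n1 + 8184 * ((a - 6 - n1) / 8)) 63630.

(** The chains need only enough factors 2, so the bounds may be evaluated at any [a0] from 12 to
    [a]. *)
Lemma min_exponents (N a b c d e f w a0 : Z) :
  factored N a b c d e f w -> good_below N -> (slack N < 0)%R ->
  12 <= a0 <= a -> 11 <= b ->
  min_c a0 b <= c /\ min_d a0 b <= d /\ min_e a0 b <= e /\ min_f a0 b <= f.
Proof.
  intros HF Hgood Hneg Ha Hb.
  destruct (first_exponents N a b c d e f w HF Hgood Hneg ltac:(lia) ltac:(lia))
    as (Hc & Hd & He & Hf).
  repeat split; apply least_above_le; try lia.
  - set (n1 := Z.min (a0 - 6) b). assert (D := div_bounds (a0 - 6 - n1) 4 ltac:(lia)).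
    assert (H := strip5 N a b c d e f w n1 ((a0 - 6 - n1) / 4) HF Hgood
      ltac:(lia) ltac:(lia) ltac:(lia) ltac:(lia)). use H. lia.
  - assert (D1 := div_bounds (a0 - 4) 2 ltac:(lia)).
    assert (D2 := div_bounds (b - 1) 2 ltac:(lia)).
    set (n1 := Z.min ((a0 - 4) / 2) ((b - 1) / 2)).
    assert (D := div_bounds (a0 - 4 - 2 * n1) 3 ltac:(lia)).
    assert (H := strip7 N a b c d e f w n1 ((a0 - 4 - 2 * n1) / 3) HF Hgood
      ltac:(lia) ltac:(lia) ltac:(lia) ltac:(lia) ltac:(lia)). use H. lia.
  - assert (D1 := div_bounds (a0 - 5) 2 ltac:(lia)).
    set (n1 := Z.min ((a0 - 5) / 2) (b - 2)).
    assert (D := div_bounds (a0 - 5 - 2 * n1) 10 ltac:(lia)).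
    assert (H := strip11 N a b c d e f w n1 ((a0 - 5 - 2 * n1) / 10) HF Hgood
      ltac:(lia) ltac:(lia) ltac:(lia) ltac:(lia) ltac:(lia) ltac:(lia)). use H. lia.
  - assert (D1 := div_bounds (b - 2) 2 ltac:(lia)).
    set (n1 := Z.min (a0 - 6) ((b - 2) / 2)).
    assert (D := div_bounds (a0 - 6 - n1) 8 ltac:(lia)).
    assert (H := strip17 N a b c d e f w n1 ((a0 - 6 - n1) / 8) HF Hgood
      ltac:(lia) ltac:(lia) ltac:(lia) ltac:(lia) ltac:(lia) ltac:(lia) ltac:(lia)).
    use H. lia.
Qed.

Definition short_ok (a b : Z) : bool :=
  3977 * a <=? 18069 + 1246 * ((b - 1) mod 2) + 12492 * ((b - 1) / 2).

Definition long_ok (a b : Z) : bool :=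
  let c := min_c a b in let d := min_d a b in
  let e := min_e a b in let f := min_f a b in
  let u := Z.min (c - 1) (Z.min d (e - 1)) in
  (1 <=? f) && (0 <=? u)
  && (65 <=? mono 0 0 (c - 1 - u) (d - u) (e - u) 0)
  && (3977 * a <=? 30115 + 1246 * ((b - 3) mod 2) + 12492 * ((b - 3) / 2)
                   + 6370 * (f - 1) + 13507 * u).

Definition ternary_ok (a b : Z) : bool :=
  let c := min_c a b in let d := min_d a b in
  let e := min_e a b in let f := min_f a b in
  (* The reserve must reach 55: 11^2 suffices alone, and a single 11 takes 2^3 besides. *)
  let z := if 2 <=? e then 0 else 3 in
  let r := a - 7 - z in
  let n136 := Z.min f (r / 3) in
  let n28 := Z.min d ((r - 3 * n136) / 2) in
  let n10 := Z.min (r - 3 * n136 - 2 * n28) (c - 3) in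
  let n4 := (r - 3 * n136 - 2 * n28 - n10) / 2 in
  (1 <=? e) && (0 <=? n136) && (0 <=? n28) && (0 <=? n10) && (0 <=? n4)
  && (8754 * b <=? 33853 + 2046 * n4 + 6447 * n10 + 15103 * n28 + 14439 * n136).

(* [strip2] applies for [a < 9 * b / 4 - 1], [strip3] for larger [a]; as [strip3] uses
   only lower bounds for the exponents, it suffices to test it at the threshold. *)
Definition range_ok (lo hi : Z) : bool :=
  forallb (fun i =>
    let b := Z.of_nat i in let a0 := 9 * b / 4 - 1 in
    ternary_ok a0 b &&
    forallb (fun j => let a := Z.of_nat j in short_ok a b || long_ok a b)
            (seq 12 (Z.to_nat (a0 - 12))))
    (seq (Z.to_nat lo) (Z.to_nat (hi - lo))).

Lemma range_11_50 : range_ok 11 50 = true.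
Proof. vm_compute. reflexivity. Qed.

Lemma middle_exponents (N a b c d e f w : Z) :
  factored N a b c d e f w -> good_below N -> (slack N < 0)%R ->
  12 <= a -> 11 <= b < 50 -> False.
Proof.
  intros HF Hgood Hneg Ha Hb.
  destruct (first_exponents N a b c d e f w HF Hgood Hneg ltac:(lia) ltac:(lia))
    as (Hc & Hd & He & Hf).
  assert (Hok := range_11_50). unfold range_ok in Hok. rewrite forallb_forall in Hok.
  specialize (Hok (Z.to_nat b)). rewrite in_seq, Z2Nat.id in Hok by lia.
  specialize (Hok ltac:(lia)). apply andb_true_iff in Hok. destruct Hok as [Ht Hlow].
  assert (D := div_bounds (9 * b) 4 ltac:(lia)).
  set (a0 := 9 * b / 4 - 1) in *.
  destruct (Z_lt_le_dec a a0) as [Haa | Haa].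
  - clear Ht. rewrite forallb_forall in Hlow. specialize (Hlow (Z.to_nat a)).
    rewrite in_seq, Z2Nat.id in Hlow by lia. specialize (Hlow ltac:(lia)).
    apply orb_true_iff in Hlow. destruct Hlow as [H | H].
    + unfold short_ok in H. apply Z.leb_le in H.
      assert (D1 := div_bounds (b - 1) 2 ltac:(lia)).
      assert (E1 := Z.div_mod (b - 1) 2 ltac:(lia)).
      assert (M1 := Z.mod_pos_bound (b - 1) 2 ltac:(lia)).
      assert (HS := strip2_short N a b c d e f w ((b - 1) mod 2) ((b - 1) / 2) HF
        Hgood ltac:(lia) ltac:(lia) Hc Hd ltac:(lia) ltac:(lia) ltac:(lia)).
      use HS. lia.
    + destruct (min_exponents N a b c d e f w a HF Hgood Hneg ltac:(lia) ltac:(lia))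
        as (Gc & Gd & Ge & Gf).
      unfold long_ok in H. cbv zeta in H.
      set (u := Z.min (min_c a b - 1) (Z.min (min_d a b) (min_e a b - 1))) in *.
      rewrite !andb_true_iff, !Z.leb_le in H. destruct H as (((H1 & H2) & H3) & H4).
      assert (E1 := Z.div_mod (b - 3) 2 ltac:(lia)).
      assert (M1 := Z.mod_pos_bound (b - 3) 2 ltac:(lia)).
      (* [u] is computed from the lower bounds; the true exponents only enlarge the leftover
         factor. *)
      assert (HL := mono_le 0 0 (min_c a b - 1 - u) (min_d a b - u) (min_e a b - u) 0
        0 0 (c - 1 - u) (d - u) (e - u) 0).
      assert (HB := strip2_long N a b c d e f w ((b - 3) mod 2) ((b - 3) / 2)
        (min_f a b - 1) u HF Hgood ltac:(lia) ltac:(lia) ltac:(lia) ltac:(lia)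
        ltac:(lia) ltac:(lia) ltac:(lia) ltac:(lia) ltac:(lia) ltac:(lia)
        ltac:(lia)).
      use HB. lia.
  - clear Hlow.
    destruct (min_exponents N a b c d e f w a0 HF Hgood Hneg ltac:(lia) ltac:(lia))
      as (Gc & Gd & Ge & Gf).
    unfold ternary_ok in Ht. cbv zeta in Ht.
    set (z := if 2 <=? min_e a0 b then 0 else 3) in *.
    assert (Hz : 0 <= z /\ (2 <= min_e a0 b \/ z = 3)).
    { unfold z. destruct (Z.leb_spec 2 (min_e a0 b)); lia. }
    set (n136 := Z.min (min_f a0 b) ((a0 - 7 - z) / 3)) in *.
    set (n28 := Z.min (min_d a0 b) ((a0 - 7 - z - 3 * n136) / 2)) in *.
    set (n10 := Z.min (a0 - 7 - z - 3 * n136 - 2 * n28) (min_c a0 b - 3)) in *.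
    set (n4 := (a0 - 7 - z - 3 * n136 - 2 * n28 - n10) / 2) in *.
    rewrite !andb_true_iff, !Z.leb_le in Ht.
    destruct Ht as (((((H1 & H2) & H3) & H4) & H5) & H6).
    assert (D4 := div_bounds (a0 - 7 - z - 3 * n136 - 2 * n28 - n10) 2 ltac:(lia)).
    fold n4 in D4.
    assert (HT := strip3_long N a b c d e f w n4 n10 n28 n136 z HF Hgood
      ltac:(lia) ltac:(lia) ltac:(lia) ltac:(lia) ltac:(lia) ltac:(lia)
      ltac:(lia) ltac:(lia) ltac:(lia)
      (mono_11_large z e ltac:(lia) ltac:(lia))).
    use HT. lia.
Qed.

(** * Strong induction over all cases *)

Lemma slack_nonneg (N : Z) : 1 < N -> (0 <= slack N)%R.
Proof.
  intros HN. assert (HN0 : 0 <= N) by lia. revert HN. pattern N.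
  apply Z_lt_induction; [|exact HN0]. clear N HN0. intros N IH HN.
  assert (Hgood : good_below N) by (intros y Hy; apply IH; lia). clear IH.
  destruct (Z_le_gt_dec N 23) as [Hs | Hl];
    [apply slack_nonneg_small; lia || assumption|].
  destruct (Z.eq_dec (N mod 12) 11) as [H11 | H11];
    [|apply slack_nonneg_mod12; lia || assumption].
  destruct (factored_exists N ltac:(lia)) as (a & b & c & d & e & f & w & HF).
  assert (Hab : 2 <= a /\ 1 <= b).
  { assert (HF' := HF). split_factored HF'.
    assert (E := Z.div_mod N 12 ltac:(lia)). rewrite H11 in E.
    assert (H2 : (4 | mono a b c d e f * w)) by (exists (3 * (N / 12 + 1)); lia).
    assert (H3 : (3 | mono a b c d e f * w)) by (exists (4 * (N / 12 + 1)); lia).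
    split.
    - destruct (Z_le_gt_dec 2 a); [assumption|exfalso].
      assert (Hm : ~ (2 | mono 0 b c d e f * w)) by not_divide.
      assert (Hc' : a = 0 \/ a = 1) by lia. apply Hm.
      destruct Hc' as [-> | ->].
      + apply Z.divide_trans with (2 := H2). exists 2. reflexivity.
      + destruct H2 as [v Hv]. exists v. revert Hv. unfold mono.
        rewrite Z.pow_1_r, Z.pow_0_r. lia.
    - destruct (Z_le_gt_dec 1 b); [assumption|exfalso].
      assert (b = 0) by lia. subst b. revert H3. not_divide. }
  destruct (Rle_or_lt 0 (slack N)) as [|Hneg]; [assumption|exfalso].
  assert (Hsmall := slack_nonneg_small_exponents N a b c d e f w HF Hgood ltac:(lia)
    ltac:(lia) ltac:(lia)).
  assert (Hr : ~ (a <= 7 \/ b <= 4 \/ c = 0)) by (intros H; apply Hsmall in H; lra).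
  assert (Hc : 0 <= c) by (split_factored HF; lia).
  destruct (Z_le_gt_dec b 10) as [Hb | Hb].
  { apply (medium_exponents N a b c d e f w); lia || assumption. }
  assert (Hd : 1 <= d).
  { assert (H := strip7 N a b c d e f w 2 0 HF Hgood ltac:(lia) ltac:(lia)
      ltac:(lia) ltac:(lia) ltac:(lia)). use H. lia. }
  (* For [a] from 8 to 11 the tree for -1/2 modulo 3^5 5 7 suffices whatever the size of [b]. *)
  destruct (Z_le_gt_dec a 11) as [Ha | Ha].
  { assert (H := strip2_win N a b c d e f w (mono 0 5 1 1 0 0) 5 1 1
      (3977 * 11 - 6023) binary_5 HF Hgood Hneg ltac:(lia) ltac:(lia) ltac:(lia)
      ltac:(lia) ltac:(lia) eq_refl ltac:(vm_compute; reflexivity)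
      ltac:(vm_compute; reflexivity)). lia. }
  destruct (Z_lt_le_dec b 50).
  { apply (middle_exponents N a b c d e f w); lia || assumption. }
  destruct (Z_le_gt_dec (4 * a) (9 * b)).
  - apply (large_exponents_low N a b c d e f w); lia || assumption.
  - apply (large_exponents_high N a b c d e f w); lia || assumption.
Qed.

Theorem theorem1 (n : nat) (hn : (1 < n)%nat) :
  (INR (complexity n) <= 41 / ln 55296 * ln (INR n))%R.
Proof.
  assert (H := slack_nonneg (Z.of_nat n) ltac:(lia)).
  unfold slack, rate in H. rewrite Nat2Z.id, <- INR_IZR_INZ in H. lra.
Qed.
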